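(* Let $0\le k\le n$, let $\mathcal V$ be a left cyclic polarized arrangement in $\mathbb R^n$ with $\dim V=k$, let $S\subset\{1,\dots,n\}$ with $|S|=k$, and let $\alpha\in\mathcal P$ be the sign vector with $\mathbf x_\alpha=S$. Work over $\mathbb F_2$ and ignore gradings. Give the left $\mathcal B_l(n,k)$-module $X_S$ (the part with right idempotent $I_S$ of the module of the change-of-basis Heegaard diagram) the differential arising from the bigon maps. Then the identification of $X_S$ with the projective resolution of the standard module $\tilde V_\alpha$ over $\tilde B(\mathcal V)\cong\mathcal B_l(n,k)$, which identifies the summand of $X_S$ for a generator $\gamma$ with the summand $\tilde P_\beta$ for the $\beta\in\mathcal P$ corresponding to $\mathbf y_\gamma\in V_l(n,k)$, preserves differentials.
   Context: **Ozsváth–Szabó algebra.** Let $V(n,k)$ be the set of $k$-element subsets of $\{0,\dots,n\}$. $\mathcal B(n,k)$ (over $\mathbb F_2$) is the path algebra (paths composed left to right) of the quiver with vertex set $V(n,k)$ and arrows: for $1\le i\le n$, $R_i$ from $\mathbf x$ to $\mathbf y$ and $L_i$ from $\mathbf y$ to $\mathbf x$ whenever $\mathbf x\cap\{i-1,i\}=\{i-1\}$ and $\mathbf y=(\mathbf x\setminus\{i-1\})\cup\{i\}$; a loop $U_i$ at every $\mathbf x$; modulo $R_iU_j=U_jR_i$, $L_iU_j=U_jL_i$, $U_iU_j=U_jU_i$; $R_iL_i=U_i$, $L_iR_i=U_i$; $R_iR_j=R_jR_i$, $L_iL_j=L_jL_i$, $L_iR_j=R_jL_i$ for $|i-j|>1$;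 $R_{i-1}R_i=0$, $L_iL_{i-1}=0$; $U_i\mathbf I_{\mathbf x}=0$ if $\mathbf x\cap\{i-1,i\}=\emptyset$. $V_l(n,k)$ is the set of $k$-subsets of $\{0,\dots,n-1\}$ and $\mathcal B_l(n,k)=\bigoplus_{\mathbf x,\mathbf x'\in V_l(n,k)}\mathbf I_{\mathbf x}\mathcal B(n,k)\mathbf I_{\mathbf x'}$. **The module $X_S$.** The Heegaard diagram has blue circles $1,\dots,n$, top red arcs $1,\dots,n$ and bottom red arcs $0,\dots,n-1$; blue circle $j$ meets top arc $j$ and bottom arcs $j-1$ and (if $j<n$) $j$, once each. A generator $\gamma$ chooses one intersection point on each blue circle so that each red arc has at most one chosen point; its right idempotent is $I_S$ if the occupied top arcs are exactly those in $S$. Thus generators with right idempotent $I_S$ are injective maps $\gamma:\{1,\dots,n\}\setminus S\to\{0,\dots,n-1\}$ with $\gamma(j)\in\{j-1,j\}$. Let $\mathbf y_\gamma\in V_l(n,k)$ be the set of unoccupied bottom arcs (complement of the image of $\gamma$). $X_S=\bigoplus_\gamma\mathcal B_l(n,k)\mathbf I_{\mathbf y_\gamma}$, with generators $x_\gamma$. The bigon differential is $d(a\,x_\gamma)=\sum aR_i\,x_{\gamma'}$, summed over all $(i,\gamma')$ such that $\gamma(i)=i$ and $\gamma'$ (again a generator) agrees with $\gamma$ except that $\gamma'(i)=i-1$; here $R_i$ is the arrow from $\mathbf y_\gamma$ to $\mathbf y_{\gamma'}$. **Arrangements.** Let $I=\{1,\dots,n\}$. A polarized arrangement $\mathcal V=(V,\eta,\xi)$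 consists of a $k$-dimensional subspace $V\subset\mathbb R^n$, $\eta\in\mathbb R^n/V$, $\xi\in V^*$ such that every lift of $\eta$ to $\mathbb R^n$ has at least $n-k$ nonzero entries and every lift of $\xi$ to $(\mathbb R^n)^*$ has at least $k$ nonzero entries. Put $V_\eta=\{x\in\mathbb R^n:x+V=\eta\}$, $H_i=\{x\in V_\eta:x_i=0\}$, $H_T=\bigcap_{i\in T}H_i$ ($H_\emptyset=V_\eta$), $\Delta_\alpha=\{x\in V_\eta:\alpha(i)x_i\ge0\ \forall i\}$, $\Sigma_\alpha=\{x\in V:\alpha(i)x_i\ge0\ \forall i\}$; $\mathcal P$ is the set of $\alpha\in\{\pm1\}^n$ with $\Delta_\alpha\ne\emptyset$ and $\xi(\Sigma_\alpha)$ bounded above; $\mathbf x_\alpha$ is the $k$-subset such that $\xi$ attains its maximum on $\Delta_\alpha$ at the point $H_{\mathbf x_\alpha}$. $\mathcal V$ is left cyclic if $V+\langle\eta\rangle\in\mathrm{Gr}^{>0}_{k+1,n}$, $(\xi,\mathrm{id})(V)\in\mathrm{Gr}^{>0}_{k,n+1}$ (first coordinate $\xi$), and the first coordinate of the orthogonal projection to $V^\perp$ of a lift of $\eta$ is positive, where $\mathrm{Gr}^{>0}$ means all Plücker coordinates nonzero of the same sign (for $k=n$, where $\eta=0$, the conditions on $\eta$ are omitted). In the left cyclic case $\alpha\in\mathcal P$ corresponds to $\mathbf y\in V_l(n,k)$ by $\mathbf y=\{i-1:i\in\mathbf x_\alpha\}$. **The algebra and the resolution.** With $u_T=\prod_{i\in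 T}u_i$, $\tilde B(\mathcal V)=\bigoplus_{\alpha,\beta\in\mathcal P}\mathbb F_2[u_1,\dots,u_n]/(u_T:\Delta_\alpha\cap\Delta_\beta\cap H_T=\emptyset)$, with unit $f_{\alpha,\beta}$ in the $(\alpha,\beta)$-summand and $f_{\alpha,\beta}f_{\beta,\gamma}=u_Tf_{\alpha,\gamma}$, $T=\{i:\alpha(i)=\gamma(i)\ne\beta(i)\}$; $e_\alpha=f_{\alpha,\alpha}$, $\tilde P_\alpha=\tilde B(\mathcal V)e_\alpha$. There is an isomorphism $\tilde B(\mathcal V)\cong\mathcal B_l(n,k)$ sending $e_\beta$ to $\mathbf I_{\mathbf y}$ ($\mathbf y$ corresponding to $\beta$), $u_i$ to $U_i$, and $f_{\beta,\beta'}$, for $\beta,\beta'$ differing only in entry $i$, to the arrow $R_i$ or $L_i$ between the corresponding vertices. $\tilde V_\alpha=\tilde Be_\alpha/\sum_{\beta<\alpha}\tilde Be_\beta\tilde Be_\alpha$, where the partial order on $\mathcal P$ is generated by $\beta<\alpha$ when $|\mathbf x_\alpha\cap\mathbf x_\beta|=k-1$ and $\xi(H_{\mathbf x_\beta})<\xi(H_{\mathbf x_\alpha})$. Its projective resolution is $\bigoplus_{T\subset\mathbf x_\alpha^c}\tilde P_{\alpha^T}$, where $\alpha^T$ is $\alpha$ with the entries in $T$ flipped and $\tilde P_{\alpha^T}=0$ if $\alpha^T\notin\mathcal P$, with differential the sum of the maps $\tilde P_{\alpha^T}\to\tilde P_{\alpha^{T\setminus\{i\}}}$, $i\in T$, given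 by right multiplication by $f_{\alpha^T,\alpha^{T\setminus\{i\}}}$. *)

(* Defs.v *)
From HB Require Import structures.
From mathcomp Require Import all_boot all_order all_algebra.
From mathcomp Require Import boolp classical_sets reals.
From mathcomp Require Import finmap mpoly monalg.

Set Implicit Arguments.
Unset Strict Implicit.
Unset Printing Implicit Defensive.

Import Order.TTheory GRing.Theory Num.Theory.

Local Open Scope ring_scope.
Local Open Scope quotient_scope.

Record quiver := Quiver {
  vert : finType;
  arr : finType;
  src : arr -> vert;
  tgt : arr -> vert }.

Section PathAlgebra.
Variable Q : quiver.

Fixpoint walk (x : vert Q) (w : seq (arr Q)) : bool :=
  if w is a :: w' then (src a == x) && walk (tgt a) w' else true.

Definition qpath : Type := {p : vert Q * seq (arr Q) | walk p.1 p.2}.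
HB.instance Definition _ := SubChoice.on qpath.

Definition psrc (p : qpath) : vert Q := (sval p).1.
Definition parr (p : qpath) : seq (arr Q) := (sval p).2.
Definition ptgt (p : qpath) : vert Q := last (psrc p) (map (@tgt Q) (parr p)).

Lemma walk_cat x w1 w2 :
  walk x (w1 ++ w2) = walk x w1 && walk (last x (map (@tgt Q) w1)) w2.
Proof. by elim: w1 x => //= a w1 IH x; rewrite IH andbA. Qed.

Definition pcat (p q : qpath) : option qpath :=
  if ptgt p == psrc q then insub (psrc p, parr p ++ parr q) else None.

Definition ptriv (x : vert Q) : qpath := exist _ (x, [::]) isT.

Lemma parrow_subproof (a : arr Q) : walk (src a) [:: a].
Proof. by rewrite /= eqxx. Qed.

Definition parrow (a : arr Q) : qpath :=
  exist _ (src a, [:: a]) (parrow_subproof a).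

Definition pathalg : Type := {malg 'F_2[qpath]}.
HB.instance Definition _ := GRing.Lmodule.on pathalg.

(* Non-composable paths have product zero. *)
Definition pmul (p q : qpath) : {malg 'F_2[qpath]} :=
  oapp (fun r => << r >>) 0 (pcat p q).

Definition pamul (f g : {malg 'F_2[qpath]}) : {malg 'F_2[qpath]} :=
  \sum_(p <- msupp f) \sum_(q <- msupp g) (mcoeff p f * mcoeff q g) *: pmul p q.

Definition paone : {malg 'F_2[qpath]} := \sum_(x : vert Q) << ptriv x >>.

Lemma pcatP p q : ptgt p = psrc q ->
  exists r, [/\ pcat p q = Some r, psrc r = psrc p, ptgt r = ptgt q
              & parr r = parr p ++ parr q].
Proof.
move=> e; have h : walk (psrc p) (parr p ++ parr q).
  by rewrite walk_cat (valP p) -/(ptgt p) e (valP q).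
exists (exist (fun p : vert Q * seq (arr Q) => walk p.1 p.2) (psrc p, parr p ++ parr q) h); split => //.
- by rewrite /pcat e eqxx insubT.
- by rewrite /ptgt /parr /= map_cat last_cat; congr (last _ _); exact: e.
Qed.

Lemma pcatN p q : ptgt p != psrc q -> pcat p q = None.
Proof. by rewrite /pcat => /negbTE ->. Qed.

Lemma qpath_eq p q : psrc p = psrc q -> parr p = parr q -> p = q.
Proof.
by move=> h1 h2; apply: val_inj; case: p q h1 h2 => [[a b] ?] [[c d] ?]; rewrite /psrc/parr/= => -> ->.
Qed.

Lemma pamulw (D1 D2 : {fset qpath}) f g :
  (msupp f `<=` D1)%fset -> (msupp g `<=` D2)%fset ->
  pamul f g = \sum_(p <- D1) \sum_(q <- D2) (mcoeff p f * mcoeff q g) *: pmul p q.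
Proof.
move=> h1 h2; rewrite /pamul (big_fset_incl _ h1) /=.
  apply: eq_bigr => p _; apply/big_fset_incl => // q _ /mcoeff_outdom ->.
  by rewrite mulr0 scale0r.
move=> p _ /mcoeff_outdom e.
by rewrite big1 // => q _; rewrite e mul0r scale0r.
Qed.

Lemma pamulDl : left_distributive pamul +%R.
Proof.
move=> f1 f2 g.
rewrite (@pamulw (msupp f1 `|` msupp f2)%fset (msupp g)) ?msuppD_le ?fsubset_refl //.
rewrite [X in _ = X + _](@pamulw (msupp f1 `|` msupp f2)%fset (msupp g)) ?fsubsetUl ?fsubset_refl //.
rewrite [X in _ = _ + X](@pamulw (msupp f1 `|` msupp f2)%fset (msupp g)) ?fsubsetUr ?fsubset_refl //.
rewrite -big_split /=; apply: eq_bigr => p _.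
rewrite -big_split /=; apply: eq_bigr => q _.
by rewrite mcoeffD mulrDl scalerDl.
Qed.

Lemma pamulDr : right_distributive pamul +%R.
Proof.
move=> g f1 f2.
rewrite (@pamulw (msupp g) (msupp f1 `|` msupp f2)%fset) ?msuppD_le ?fsubset_refl //.
rewrite [X in _ = X + _](@pamulw (msupp g) (msupp f1 `|` msupp f2)%fset) ?fsubsetUl ?fsubset_refl //.
rewrite [X in _ = _ + X](@pamulw (msupp g) (msupp f1 `|` msupp f2)%fset) ?fsubsetUr ?fsubset_refl //.
rewrite -big_split /=; apply: eq_bigr => p _.
rewrite -big_split /=; apply: eq_bigr => q _.
by rewrite mcoeffD mulrDr scalerDl.
Qed.

Lemma pamul0 f : pamul 0 f = 0.
Proof. by rewrite /pamul msupp0 big_seq_fset0. Qed.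

Lemma pamulr0 f : pamul f 0 = 0.
Proof. by rewrite /pamul big1 // => p _; rewrite msupp0 big_seq_fset0. Qed.

Lemma pamulUU c d p q :
  pamul << c *g p >> << d *g q >> = (c * d) *: pmul p q.
Proof.
rewrite (pamulw msuppU_le msuppU_le).
by rewrite !big_seq_fset1 !mcoeffUU.
Qed.

Lemma malgUZ c (p : qpath) : << c *g p >> = c *: << p >> :> {malg 'F_2[qpath]}.
Proof. by apply/malgP=> k; rewrite mcoeffZ !mcoeffU mulrnAr mulr1. Qed.

Lemma pamulsl (I : Type) (r : seq I) (F : I -> {malg 'F_2[qpath]}) g :
  pamul (\sum_(i <- r) F i) g = \sum_(i <- r) pamul (F i) g.
Proof. exact: (big_morph (pamul^~ g) (fun x y => pamulDl x y g) (pamul0 g)). Qed.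

Lemma pamulsr (I : Type) (r : seq I) (F : I -> {malg 'F_2[qpath]}) g :
  pamul g (\sum_(i <- r) F i) = \sum_(i <- r) pamul g (F i).
Proof. exact: (big_morph (pamul g) (fun x y => pamulDr g x y) (pamulr0 g)). Qed.

Lemma pamulZl c f g : pamul (c *: f) g = c *: pamul f g.
Proof.
rewrite (@pamulw (msupp f) (msupp g)) ?msuppZ_le ?fsubset_refl //.
rewrite /pamul scaler_sumr; apply: eq_bigr => p _.
rewrite scaler_sumr; apply: eq_bigr => q _.
by rewrite mcoeffZ scalerA mulrA.
Qed.

Lemma pamulZr c f g : pamul f (c *: g) = c *: pamul f g.
Proof.
rewrite (@pamulw (msupp f) (msupp g)) ?msuppZ_le ?fsubset_refl //.
rewrite /pamul scaler_sumr; apply: eq_bigr => p _.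
rewrite scaler_sumr; apply: eq_bigr => q _.
by rewrite mcoeffZ scalerA mulrCA.
Qed.

Lemma pamulbb p q : pamul << p >> << q >> = pmul p q.
Proof. by rewrite pamulUU mul1r scale1r. Qed.

Lemma pmulA p q r : pamul << p >> (pmul q r) = pamul (pmul p q) << r >>.
Proof.
rewrite /pmul.
have [e|ne] := eqVneq (ptgt p) (psrc q); last first.
  rewrite (pcatN ne) /= pamul0.
  have [e'|ne'] := eqVneq (ptgt q) (psrc r); last by rewrite (pcatN ne') /= pamulr0.
  have [s [-> hs _ _]] := pcatP e'.
  by rewrite /= pamulbb /pmul pcatN // hs.
have [s [-> s1 s2 s3]] := pcatP e.
have [e'|ne'] := eqVneq (ptgt q) (psrc r); last first.
  by rewrite (pcatN ne') /= pamulr0 pamulbb /pmul pcatN // s2.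
have [t [-> t1 t2 t3]] := pcatP e'.
rewrite /= !pamulbb /pmul.
have [|u [-> u1 u2 u3]] := @pcatP p t; first by rewrite e t1.
have [|v [-> v1 v2 v3]] := @pcatP s r; first by rewrite s2.
congr (<< _ >>); apply: qpath_eq; first by rewrite u1 v1 s1.
by rewrite u3 v3 t3 s3 catA.
Qed.

Lemma pamulA : associative pamul.
Proof.
move=> f g h; rewrite [f]monalgE !pamulsl; apply: eq_bigr => p _.
rewrite [g]monalgE pamulsl !pamulsr pamulsl; apply: eq_bigr => q _.
rewrite [h]monalgE !pamulsr; apply: eq_bigr => r _.
rewrite (malgUZ _ p) (malgUZ _ q) (malgUZ _ r).
rewrite !(pamulZl, pamulZr) !pamulbb pmulA.
by rewrite !scalerA; congr (_ *: _); rewrite mulrC mulrA.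
Qed.

Lemma pmul1 p x : pmul (ptriv x) p = if x == psrc p then << p >> else 0.
Proof.
rewrite /pmul; case: eqP => [e|/eqP ne]; last by rewrite pcatN.
have [|s [-> s1 s2 s3]] := @pcatP (ptriv x) p; first by [].
by congr << _ >>; apply: qpath_eq; rewrite ?s1 ?s3.
Qed.

Lemma pmulr1 p x : pmul p (ptriv x) = if x == ptgt p then << p >> else 0.
Proof.
rewrite /pmul; case: eqP => [e|/eqP ne]; last by rewrite pcatN // eq_sym.
have [|s [-> s1 s2 s3]] := @pcatP p (ptriv x); first by rewrite -e.
by congr << _ >>; apply: qpath_eq; rewrite ?s1 ?s3 // cats0.
Qed.

Lemma pamul1l : left_id paone pamul.
Proof.
move=> f; rewrite [f]monalgE pamulsr; apply: eq_bigr => p _.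
rewrite malgUZ pamulZr pamulsl; congr (_ *: _).
rewrite (bigD1 (psrc p)) //= pamulbb pmul1 eqxx big1 ?addr0 // => x /negbTE ne.
by rewrite pamulbb pmul1 ne.
Qed.

Lemma pamul1r : right_id paone pamul.
Proof.
move=> f; rewrite [f]monalgE pamulsl; apply: eq_bigr => p _.
rewrite malgUZ pamulZl pamulsr; congr (_ *: _).
rewrite (bigD1 (ptgt p)) //= pamulbb pmulr1 eqxx big1 ?addr0 // => x /negbTE ne.
by rewrite pamulbb pmulr1 ne.
Qed.

HB.instance Definition _ := GRing.Zmodule_isPzRing.Build pathalg
  pamulA pamul1l pamul1r pamulDl pamulDr.

Definition triv (x : vert Q) : pathalg := << ptriv x >>.
Definition arrow (a : arr Q) : pathalg := << parrow a >>.

Lemma trivM v w : triv v * triv w = if v == w then triv v else 0.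
Proof.
rewrite -[_ * _]/(pamul _ _) pamulbb pmul1 /psrc /=.
by case: eqP => // ->.
Qed.

End PathAlgebra.

(* The two-sided ideal generated by the elements satisfying X. *)
Inductive gen_ideal (A : pzRingType) (X : A -> Prop) : A -> Prop :=
| gen_ideal0 : gen_ideal X 0
| gen_idealS a r b u : X r -> gen_ideal X u -> gen_ideal X (a * r * b + u).

Section GenIdeal.
Variables (A : pzRingType) (X : A -> Prop).

Lemma gen_idealD u v : gen_ideal X u -> gen_ideal X v -> gen_ideal X (u + v).
Proof.
elim=> [|a r b w Xr _ IH] hv; first by rewrite add0r.
by rewrite -addrA; apply: gen_idealS => //; apply: IH.
Qed.

Lemma gen_idealMl c u : gen_ideal X u -> gen_ideal X (c * u).
Proof.
elim=> [|a r b w Xr _ IH]; first by rewrite mulr0; apply: gen_ideal0.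
by rewrite mulrDr !mulrA; apply: gen_idealS.
Qed.

Lemma gen_idealMr c u : gen_ideal X u -> gen_ideal X (u * c).
Proof.
elim=> [|a r b w Xr _ IH]; first by rewrite mul0r; apply: gen_ideal0.
by rewrite mulrDl -mulrA; apply: gen_idealS.
Qed.

Lemma gen_idealN u : gen_ideal X u -> gen_ideal X (- u).
Proof. by move=> h; rewrite -mulN1r; apply: gen_idealMl. Qed.

Lemma gen_ideal_sum (I : Type) (s : seq I) (P : pred I) (F : I -> A) :
  (forall i, P i -> gen_ideal X (F i)) ->
  gen_ideal X (\sum_(i <- s | P i) F i).
Proof.
by move=> h; elim/big_ind: _ => //; [apply: gen_ideal0 | apply: gen_idealD].
Qed.

Lemma gen_ideal_mem r : X r -> gen_ideal X r.
Proof.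
move=> Xr; have := gen_idealS 1 1 Xr (gen_ideal0 X).
by rewrite mul1r mulr1 addr0.
Qed.

End GenIdeal.

Record ideal2 (A : pzRingType) := Ideal2 {
  ideal2_pred :> zmodClosed A;
  ideal2_Ml : forall a u, u \in ideal2_pred ->
     a * u \in ideal2_pred;
  ideal2_Mr : forall a u, u \in ideal2_pred ->
     u * a \in ideal2_pred }.

Section QuotientRing.
Variables (A : pzRingType) (I : ideal2 A).

Definition rquot : Type := {ideal_quot (ideal2_pred I)}.
HB.instance Definition _ := GRing.Zmodule.on rquot.

Definition rpi (a : A) : rquot := \pi_{ideal_quot (ideal2_pred I)} a.
Definition rrepr (x : rquot) : A := repr (x : {ideal_quot (ideal2_pred I)}).
Definition rquot_mul (x y : rquot) : rquot := rpi (rrepr x * rrepr y).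

Lemma rpiP a b : (a - b \in ideal2_pred I) <-> rpi a = rpi b.
Proof.
by rewrite Quotient.idealrBE; split => /eqP.
Qed.

Lemma rreprK x : rpi (rrepr x) = x.
Proof. exact: reprK. Qed.

Lemma rpiD a b : rpi (a + b) = rpi a + rpi b.
Proof. by rewrite /rpi !piE. Qed.

Lemma rpiM a b : rpi (a * b) = rquot_mul (rpi a) (rpi b).
Proof.
apply/rpiP; rewrite -(subrK (a * rrepr (rpi b)) (a * b)) -addrA -mulrBr -mulrBl.
apply: rpredD.
  by apply: ideal2_Ml; apply/rpiP; rewrite rreprK.
by apply: ideal2_Mr; apply/rpiP; rewrite rreprK.
Qed.

Lemma rquot_mulA : associative rquot_mul.
Proof.
by move=> x y z; rewrite -[x]rreprK -[y]rreprK -[z]rreprK -!rpiM mulrA.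
Qed.
Lemma rquot_mul1r : left_id (rpi 1) rquot_mul.
Proof. by move=> x; rewrite -[x]rreprK -!rpiM mul1r. Qed.
Lemma rquot_mulr1 : right_id (rpi 1) rquot_mul.
Proof. by move=> x; rewrite -[x]rreprK -!rpiM mulr1. Qed.
Lemma rquot_mulDl : left_distributive rquot_mul +%R.
Proof.
move=> x y z; rewrite -[x]rreprK -[y]rreprK -[z]rreprK.
by rewrite -rpiD -!rpiM -rpiD mulrDl.
Qed.
Lemma rquot_mulDr : right_distributive rquot_mul +%R.
Proof.
move=> x y z; rewrite -[x]rreprK -[y]rreprK -[z]rreprK.
by rewrite -rpiD -!rpiM -rpiD mulrDr.
Qed.

HB.instance Definition _ := GRing.Zmodule_isPzRing.Build rquot
  rquot_mulA rquot_mul1r rquot_mulr1 rquot_mulDl rquot_mulDr.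

Lemma rpi_mul a b : rpi (a * b) = rpi a * rpi b.
Proof. exact: rpiM. Qed.

Lemma rpi0 : rpi 0 = 0.
Proof. by rewrite /rpi !piE. Qed.

End QuotientRing.

Section QuotientByRelations.
Variables (A : pzRingType) (X : A -> Prop).

Definition gen_ideal_pred : A -> bool := fun a => `[< gen_ideal X a >].

Lemma gen_ideal_zmod : zmod_closed gen_ideal_pred.
Proof.
split; first by apply/asboolP; apply: gen_ideal0.
move=> u v /asboolP hu /asboolP hv; apply/asboolP.
by apply: gen_idealD => //; apply: gen_idealN.
Qed.
HB.instance Definition _ := GRing.isZmodClosed.Build A gen_ideal_pred gen_ideal_zmod.

Lemma gen_ideal_Ml a u : u \in gen_ideal_pred ->
  a * u \in gen_ideal_pred.
Proof. by move=> /asboolP h; apply/asboolP; apply: gen_idealMl. Qed.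

Lemma gen_ideal_Mr a u : u \in gen_ideal_pred ->
  u * a \in gen_ideal_pred.
Proof. by move=> /asboolP h; apply/asboolP; apply: gen_idealMr. Qed.

Definition gen_ideal2 : ideal2 A := Ideal2 gen_ideal_Ml gen_ideal_Mr.

End QuotientByRelations.

Record idem (A : pzRingType) := Idem { ival : A; _ : ival * ival = ival }.

Lemma idemP (A : pzRingType) (e : idem A) : ival e * ival e = ival e.
Proof. by case: e. Qed.

Section Corner.
Variables (A : pzRingType) (e : idem A).

Definition corner_pred : A -> bool := fun a => ival e * a * ival e == a.

Lemma corner_zmod : zmod_closed corner_pred.
Proof.
split; first by rewrite unfold_in mulr0 mul0r.
move=> u v /eqP hu /eqP hv.
by rewrite unfold_in mulrBr mulrBl hu hv.
Qed.
HB.instance Definition _ := GRing.isZmodClosed.Build A corner_pred corner_zmod.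

(* The ring e A e, with unit e. *)
Definition corner : Type := {a : A | corner_pred a}.
HB.instance Definition _ := SubChoice.on corner.
HB.instance Definition _ := [SubChoice_isSubZmodule of corner by <:].

Lemma to_corner_subproof a : corner_pred (ival e * a * ival e).
Proof. by rewrite /corner_pred !mulrA idemP -!mulrA idemP. Qed.

Definition to_corner (a : A) : corner := exist corner_pred _ (to_corner_subproof a).

Definition corner_mul (x y : corner) : corner := to_corner (val x * val y).

Lemma corner_eMr (x : corner) : ival e * val x = val x.
Proof. by rewrite -{1}(eqP (valP x)) !mulrA idemP (eqP (valP x)). Qed.
Lemma corner_eMl (x : corner) : val x * ival e = val x.
Proof. by rewrite -{1}(eqP (valP x)) -!mulrA idemP mulrA (eqP (valP x)). Qed.

Lemma corner_mulE x y : val (corner_mul x y) = val x * val y.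
Proof. by rewrite /= mulrA corner_eMr -mulrA corner_eMl. Qed.

Lemma corner_valD (x y : corner) : val (x + y) = val x + val y.
Proof. by []. Qed.

Lemma corner_mulA : associative corner_mul.
Proof. by move=> x y z; apply: val_inj; rewrite !corner_mulE mulrA. Qed.
Lemma corner_oneE : val (to_corner 1) = ival e.
Proof. by rewrite /= mulr1 idemP. Qed.
Lemma corner_mul1r : left_id (to_corner 1) corner_mul.
Proof. by move=> x; apply: val_inj; rewrite corner_mulE corner_oneE corner_eMr. Qed.
Lemma corner_mulr1 : right_id (to_corner 1) corner_mul.
Proof. by move=> x; apply: val_inj; rewrite corner_mulE corner_oneE corner_eMl. Qed.
Lemma corner_mulDl : left_distributive corner_mul +%R.
Proof. by move=> x y z; apply: val_inj; rewrite corner_valD !corner_mulE corner_valD mulrDl. Qed.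
Lemma corner_mulDr : right_distributive corner_mul +%R.
Proof. by move=> x y z; apply: val_inj; rewrite corner_valD !corner_mulE corner_valD mulrDr. Qed.

HB.instance Definition _ := GRing.Zmodule_isPzRing.Build corner
  corner_mulA corner_mul1r corner_mulr1 corner_mulDl corner_mulDr.

Lemma to_corner_idem a : ival e * a = a * ival e -> a * a = a ->
  to_corner a * to_corner a = to_corner a.
Proof.
move=> ea aa; apply: val_inj; rewrite [LHS]corner_mulE.
have -> : val (to_corner a) = a * ival e.
  by rewrite -[LHS]/(ival e * a * ival e) ea -mulrA idemP.
by rewrite mulrA -(mulrA a) ea mulrA aa -mulrA idemP.
Qed.

End Corner.

Section ProjectiveSum.
Variables (A : pzRingType) (I : finType) (u : I -> idem A).

Definition dsum_pred : {ffun I -> A^o} -> bool :=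
  fun f => [forall i, (f i : A) * ival (u i) == f i].

Lemma dsum_submod : submod_closed dsum_pred.
Proof.
split; first by apply/forallP => i; rewrite ffunE mul0r.
move=> a f g /forallP hf /forallP hg; apply/forallP => i; rewrite !ffunE.
by rewrite mulrDl (eqP (hg i)) -[_ *: _]/(a * _) -mulrA (eqP (hf i)).
Qed.
HB.instance Definition _ :=
  GRing.isSubmodClosed.Build A {ffun I -> A^o} dsum_pred dsum_submod.

(* The left module given by the direct sum over i of A (u i); the left ideal
   A e of an idempotent e consists of the a with a e = a. *)
Definition dsum : Type := {f : {ffun I -> A^o} | dsum_pred f}.
HB.instance Definition _ := SubChoice.on dsum.
HB.instance Definition _ := [SubChoice_isSubZmodule of dsum by <:].
HB.instance Definition _ := [SubZmodule_isSubLmodule of dsum by <:].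

Definition coor (x : dsum) (i : I) : A := sval x i.

Lemma right_mult_subproof (M : I -> I -> A) (x : dsum) :
  dsum_pred [ffun j => \sum_i coor x i * M i j * ival (u j)].
Proof.
apply/forallP => j; rewrite ffunE mulr_suml; apply/eqP/eq_bigr => i _.
by rewrite -mulrA idemP.
Qed.

(* The map whose component A (u i) -> A (u j) is right multiplication by
   M i j; the factor u j has no effect if M i j lies in A (u j). *)
Definition right_mult (M : I -> I -> A) (x : dsum) : dsum :=
  exist dsum_pred _ (right_mult_subproof M x).

End ProjectiveSum.

Section OzsvathSzabo.
Variables n k : nat.

(* The indices 1, ..., n are represented by 'I_n, where i : 'I_n stands for
   i + 1; so R_(i+1) moves the element lo i = i of {0, ..., n} to hi i = i + 1. *)
Definition lo (i : 'I_n) : 'I_n.+1 := widen_ord (leqnSn n) i.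
Definition hi (i : 'I_n) : 'I_n.+1 := lift ord0 i.

Definition Vnk : Type := {x : {set 'I_n.+1} | #|x| == k}.
HB.instance Definition _ := SubFinite.on Vnk.

Definition Rrel (i : 'I_n) (x y : {set 'I_n.+1}) : bool :=
  (x :&: [set lo i; hi i] == [set lo i])
  && (y == (x :\ lo i) :|: [set hi i]).

Definition Rarr : Type :=
  {a : 'I_n * (Vnk * Vnk) | Rrel a.1 (sval a.2.1) (sval a.2.2)}.
HB.instance Definition _ := SubFinite.on Rarr.

Definition Ridx (a : Rarr) : 'I_n := (sval a).1.
Definition Rsrc (a : Rarr) : Vnk := (sval a).2.1.
Definition Rtgt (a : Rarr) : Vnk := (sval a).2.2.

(* inl (inl a) is the arrow R_i, inl (inr a) is its reverse L_i, and
   inr (i, x) is the loop U_i at x. *)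
Definition OSarr : Type := (Rarr + Rarr + 'I_n * Vnk)%type.
HB.instance Definition _ := Finite.on OSarr.

Definition OSsrc (a : OSarr) : Vnk :=
  match a with
  | inl (inl r) => Rsrc r
  | inl (inr l) => Rtgt l
  | inr u => u.2
  end.

Definition OStgt (a : OSarr) : Vnk :=
  match a with
  | inl (inl r) => Rtgt r
  | inl (inr l) => Rsrc l
  | inr u => u.2
  end.

Definition OSquiver : quiver := Quiver OSsrc OStgt.

Definition pathOS : pzRingType := pathalg OSquiver.

Definition parr1 (a : OSarr) : pathOS := arrow (a : arr OSquiver).
Definition pvert (x : Vnk) : pathOS := triv (x : vert OSquiver).

(* As elements of the path algebra, R_i, L_i and U_i are the sums of all arrows
   with that name; the arrow R_i from x to y is I_x R_i I_y. *)
Definition pR (i : 'I_n) : pathOS :=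
  \sum_(r : Rarr | Ridx r == i) parr1 (inl (inl r)).
Definition pL (i : 'I_n) : pathOS :=
  \sum_(r : Rarr | Ridx r == i) parr1 (inl (inr r)).
Definition pU (i : 'I_n) : pathOS := \sum_(x : Vnk) parr1 (inr (i, x)).

(* zero if x does not have k elements *)
Definition pI (x : {set 'I_n.+1}) : pathOS :=
  if insub x is Some v then pvert v else 0.

Definition far (i j : 'I_n) : bool := (i.+1 < j)%N || (j.+1 < i)%N.

Inductive OSrel : pathOS -> Prop :=
| RU_rel i j : OSrel (pR i * pU j - pU j * pR i)
| LU_rel i j : OSrel (pL i * pU j - pU j * pL i)
| UU_rel i j : OSrel (pU i * pU j - pU j * pU i)
| RL_rel i x : x :&: [set lo i; hi i] = [set lo i] ->
    OSrel (pI x * (pR i * pL i - pU i))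
| LR_rel i x : x :&: [set lo i; hi i] = [set hi i] ->
    OSrel (pI x * (pL i * pR i - pU i))
| RRfar_rel i j : far i j -> OSrel (pR i * pR j - pR j * pR i)
| LLfar_rel i j : far i j -> OSrel (pL i * pL j - pL j * pL i)
| LRfar_rel i j : far i j -> OSrel (pL i * pR j - pR j * pL i)
| RR_rel (i j : 'I_n) : j = i.+1 :> nat -> OSrel (pR i * pR j)
| LL_rel (i j : 'I_n) : j = i.+1 :> nat -> OSrel (pL j * pL i)
| U_rel i x : x :&: [set lo i; hi i] = finset.set0 -> OSrel (pU i * pI x).

Definition Bnk : pzRingType := rquot (gen_ideal2 OSrel).
Definition OSpi (a : pathOS) : Bnk := rpi (gen_ideal2 OSrel) a.

Definition bR i : Bnk := OSpi (pR i).
Definition bL i : Bnk := OSpi (pL i).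
Definition bU i : Bnk := OSpi (pU i).
Definition bI x : Bnk := OSpi (pI x).

Lemma pvertM (v w : Vnk) : pvert v * pvert w = if v == w then pvert v else 0.
Proof. exact: trivM. Qed.

Lemma pI_idem x : pI x * pI x = pI x.
Proof.
rewrite /pI; case: insubP => [v _ _|_]; last by rewrite mul0r.
by rewrite pvertM eqxx.
Qed.

Lemma bI_idem x : bI x * bI x = bI x.
Proof. by rewrite /bI /OSpi -rpi_mul pI_idem. Qed.

Definition pe : pathOS :=
  \sum_(x : Vnk | ord_max \notin sval x) pvert x.

Lemma peM (v : Vnk) :
  pe * pvert v =
  if ord_max \notin sval v then pvert v else 0.
Proof.
rewrite /pe mulr_suml big_mkcond /= (bigD1 v) //= big1 ?addr0.
  by case: ifP => // _; rewrite pvertM eqxx.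
by move=> w /negbTE ne; case: ifP => // _; rewrite pvertM ne.
Qed.

Lemma peMr (v : Vnk) :
  pvert v * pe =
  if ord_max \notin sval v then pvert v else 0.
Proof.
rewrite /pe mulr_sumr big_mkcond /= (bigD1 v) //= big1 ?addr0.
  by case: ifP => // _; rewrite pvertM eqxx.
by move=> w /negbTE ne; case: ifP => // _; rewrite pvertM eq_sym ne.
Qed.

Lemma pe_idem : pe * pe = pe.
Proof.
rewrite {2}/pe mulr_sumr; apply: eq_bigr => v hv.
by rewrite peM hv.
Qed.

Lemma be_subproof : OSpi pe * OSpi pe = OSpi pe.
Proof. by rewrite /OSpi -rpi_mul pe_idem. Qed.

(* The sum of the I_x over the x in V_l(n,k). *)
Definition be : idem Bnk := Idem be_subproof.

Lemma be_comm x : OSpi pe * bI x = bI x * OSpi pe.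
Proof.
rewrite /bI /OSpi -!rpi_mul; apply: congr1.
rewrite /pI; case: insubP => [v _ _|_]; last by rewrite mulr0 mul0r.
by rewrite peM peMr.
Qed.

Definition Bl : pzRingType := corner be.

(* For x and y in V_l(n,k) these are the elements I_x, I_x R_i I_y and
   I_y L_i I_x themselves, and lU i is the sum of the U_i I_x with x in
   V_l(n,k). *)
Definition lI_elt (x : {set 'I_n.+1}) : Bl := to_corner be (bI x).
Definition lU (i : 'I_n) : Bl := to_corner be (bU i).
Definition lR (i : 'I_n) (x y : {set 'I_n.+1}) : Bl :=
  to_corner be (bI x * bR i * bI y).
Definition lL (i : 'I_n) (y x : {set 'I_n.+1}) : Bl :=
  to_corner be (bI y * bL i * bI x).

Lemma lI_idem x : lI_elt x * lI_elt x = lI_elt x.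
Proof. by apply: to_corner_idem; [apply: be_comm | apply: bI_idem]. Qed.

Definition lI (x : {set 'I_n.+1}) : idem Bl := Idem (lI_idem x).

End OzsvathSzabo.

Section ModuleXS.
Variables (n k : nat) (S : {set 'I_n}).

(* j : 'I_n stands for the blue circle j + 1 and the top arc j + 1, but
   a : 'I_n for the bottom arc a; so circle j meets the bottom arcs j and
   j + 1, the latter if j + 1 < n. *)
Definition blue : Type := {j : 'I_n | j \notin S}.
HB.instance Definition _ := SubFinite.on blue.

Definition is_gen (g : {ffun blue -> 'I_n}) : bool :=
  injectiveb g &&
  [forall j : blue, (g j == sval j :> nat) || (g j == (sval j).+1 :> nat)].

Definition gen : Type := {g : {ffun blue -> 'I_n} | is_gen g}.
HB.instance Definition _ := SubFinite.on gen.

Definition yset (g : gen) : {set 'I_n.+1} :=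
  [set lo a | a in ~: [set sval g j | j : blue]].

(* g' is g with its point on the blue circle j moved from the bottom arc j + 1
   to the bottom arc j. *)
Definition bigon (j : blue) (g g' : gen) : bool :=
  [&& sval g j == (sval j).+1 :> nat, sval g' j == sval j :> nat
    & [forall j' : blue, (j' != j) ==> (sval g' j' == sval g j')]].

Definition XS : lmodType (Bl n k) := dsum (fun g : gen => lI k (yset g)).

Definition dX : XS -> XS :=
  @right_mult (Bl n k) gen (fun g : gen => lI k (yset g)) (fun g g' =>
    \sum_(j : blue | bigon j g g') lR k (sval j) (yset g) (yset g')).

End ModuleXS.

Section Arrangement.
Variables (R : realType) (n : nat).

Record arrangement := Arrangement {
  arrV : {vspace 'rV[R]_n};
  arr_eta : {ideal_quot (pred_of_vspace arrV)};
  arr_xi : 'Hom(subvs_of arrV, R^o) }.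

Variable A : arrangement.
Local Notation V := (arrV A).

Definition is_lift_eta (x : 'rV[R]_n) : Prop :=
  \pi_({ideal_quot (pred_of_vspace V)}) x = arr_eta A.

(* xi v, for v in V *)
Definition xiV (v : 'rV[R]_n) : R := arr_xi A (vsproj V v).

Definition is_lift_xi (c : 'rV[R]_n) : Prop :=
  forall v, v \in V -> \sum_(i < n) c 0 i * v 0 i = xiV v.

Definition polarized (k : nat) : Prop :=
  [/\ \dim V = k,
      forall x, is_lift_eta x -> (n - k <= #|[set i | x 0%R i != 0%R]|)%N
    & forall c, is_lift_xi c -> (k <= #|[set i | c 0%R i != 0%R]|)%N].

(* The sign vector a has entries (-1) ^+ a i. *)
Definition signs : Type := {ffun 'I_n -> bool}.
HB.instance Definition _ := Finite.on signs.

Definition flip (a : signs) (T : {set 'I_n}) : signs :=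
  [ffun i => a i (+) (i \in T)].

Local Open Scope classical_set_scope.

Definition Veta : set 'rV[R]_n := [set x | is_lift_eta x].

Definition Hflat (T : {set 'I_n}) : set 'rV[R]_n :=
  [set x | Veta x /\ forall i, i \in T -> x 0 i = 0].

Definition Delta (a : signs) : set 'rV[R]_n :=
  [set x | Veta x /\ forall i, 0 <= (-1) ^+ a i * x 0 i].

Definition Sigma (a : signs) : set 'rV[R]_n :=
  [set x | x \in V /\ forall i, 0 <= (-1) ^+ a i * x 0 i].

Definition inP (a : signs) : bool :=
  `[< Delta a !=set0 /\ exists M, forall x, Sigma a x -> xiV x <= M >].

Definition Pset : Type := {a : signs | inP a}.
HB.instance Definition _ := SubFinite.on Pset.

(* X is the set x_a; xi is defined up to an additive constant on V_eta, so
   its values there are compared through differences. *)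
Definition is_xset (a : signs) (X : {set 'I_n}) : Prop :=
  #|X| = \dim V /\
  exists p, [/\ Hflat X = [set p], Delta a p
              & forall q, Delta a q -> xiV (q - p) <= 0].

(* a is in P and corresponds to y = {i - 1 : i in x_a}. *)
Definition corr (a : signs) (y : {set 'I_n.+1}) : Prop :=
  inP a /\ exists2 X, is_xset a X & y = [set lo i | i in X]%SET.

(* W has dimension d, and the Pluecker coordinates computed in one (equivalently
   any) basis are nonzero of the same sign. *)
Definition Gr_pos (d m : nat) (W : set 'rV[R]_m) : Prop :=
  exists B : 'M[R]_(d, m),
    [/\ row_free B, forall w, W w <-> (w <= B)%MS
      & forall f g : 'I_d -> 'I_m,
          {homo f : i j / (i < j)%N} -> {homo g : i j / (i < j)%N} ->
          0 < \det (colsub f B) * \det (colsub g B)].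

(* the span of V and of any lift of eta *)
Definition V_eta_span : set 'rV[R]_n :=
  [set x | x \in (V + <[repr (arr_eta A)]>)%VS].

Definition xi_graph : set 'rV[R]_n.+1 :=
  [set w | exists2 v, v \in V &
     w = row_mx (const_mx (xiV v) : 'rV_1) v :> 'rV_(1 + n)].

(* p is the orthogonal projection of x to the orthogonal complement of V *)
Definition is_orth_proj (x p : 'rV[R]_n) : Prop :=
  x - p \in V /\ forall v, v \in V -> \sum_(i < n) v 0 i * p 0 i = 0.

Definition left_cyclic (k : nat) : Prop :=
  Gr_pos k xi_graph /\
  ((k < n)%N ->
     Gr_pos k.+1 V_eta_span /\
     exists x p, [/\ is_lift_eta x, is_orth_proj x p
                   & forall i : 'I_n, i = 0%N :> nat -> 0 < p 0 i]).

End Arrangement.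

Section ConvolutionAlgebra.
Variables (R : realType) (n : nat) (A : arrangement R n).

Local Notation Fu := (mpoly n 'F_2).

Definition Tset (a b c : signs n) : {set 'I_n} :=
  [set i | (a i == c i) && (a i != b i)].

Definition umon (T : {set 'I_n}) : Fu := \prod_(i in T) 'X_i.

(* The monomials generating the relation ideal of the summand (a, b). *)
Definition Brel (a b : signs n) (m : Fu) : Prop :=
  exists2 T : {set 'I_n},
    (Delta A a `&` Delta A b `&` Hflat A T = classical_sets.set0)%classic
    & m = umon T.

(* A direct sum of copies of F_2[u_1, ..., u_n] indexed by the pairs (a, b),
   with the multiplication f_ab f_bc = u_T f_ac; the algebra of the arrangement
   is its quotient by the direct sum of the relation ideals. *)
Definition freeB : Type := {ffun Pset A * Pset A -> Fu}.
HB.instance Definition _ := GRing.Zmodule.on freeB.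

Definition freeB_mul (M N : freeB) : freeB :=
  [ffun p => \sum_(b : Pset A)
     umon (Tset (sval p.1) (sval b) (sval p.2)) * (M (p.1, b) * N (b, p.2))].

Definition freeB_one : freeB := [ffun p => (p.1 == p.2)%:R].

Lemma umonE T : umon T = \prod_(i < n) (if i \in T then 'X_i else 1).
Proof. by rewrite /umon big_mkcond. Qed.

Lemma umon_cocycle a b c d :
  umon (Tset a c d) * umon (Tset a b c) = umon (Tset a b d) * umon (Tset b c d).
Proof.
rewrite !umonE -!big_split /=; apply: eq_bigr => i _; rewrite !inE.
by case: (a i) (b i) (c i) (d i) => [] [] [] [] /=; rewrite ?(mul1r, mulr1).
Qed.

Lemma umon0 a b : umon (Tset a a b) = 1.
Proof. by rewrite umonE big1 // => i _; rewrite inE eqxx andbF. Qed.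

Lemma umon0r a b : umon (Tset a b b) = 1.
Proof. by rewrite umonE big1 // => i _; rewrite inE; case: eqP. Qed.

Lemma freeB_mulA : associative freeB_mul.
Proof.
move=> M N L; apply/ffunP => -[a d]; rewrite !ffunE /=.
under eq_bigr => b _ do rewrite ffunE /= !mulr_sumr.
under [RHS]eq_bigr => c _ do rewrite ffunE /= mulr_suml mulr_sumr.
rewrite exchange_big /=; apply: eq_bigr => c _; apply: eq_bigr => b _.
set x := M _; set y := N _; set z := L _.
transitivity ((umon (Tset (sval a) (sval b) (sval d))
   * umon (Tset (sval b) (sval c) (sval d))) * (x * (y * z))).
  by rewrite -[RHS]mulrA; congr (_ * _); rewrite mulrCA.
rewrite -umon_cocycle -[LHS]mulrA; congr (_ * _).
by rewrite -[RHS]mulrA; congr (_ * _); rewrite mulrA.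
Qed.

Lemma freeB_mul1r : left_id freeB_one freeB_mul.
Proof.
move=> M; apply/ffunP => -[a c]; rewrite ffunE /= (bigD1 a) //= ffunE eqxx.
rewrite umon0 !mul1r big1 ?addr0 // => b /negbTE ne.
by rewrite ffunE /= eq_sym ne mul0r mulr0.
Qed.

Lemma freeB_mulr1 : right_id freeB_one freeB_mul.
Proof.
move=> M; apply/ffunP => -[a c]; rewrite ffunE /= (bigD1 c) //= ffunE eqxx.
rewrite umon0r mul1r mulr1 big1 ?addr0 // => b /negbTE ne.
by rewrite ffunE /= ne !mulr0.
Qed.

Lemma freeB_mulDl : left_distributive freeB_mul +%R.
Proof.
move=> M N L; apply/ffunP => p; rewrite !ffunE -big_split /=.
by apply: eq_bigr => b _; rewrite ffunE mulrDl mulrDr.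
Qed.

Lemma freeB_mulDr : right_distributive freeB_mul +%R.
Proof.
move=> M N L; apply/ffunP => p; rewrite !ffunE -big_split /=.
by apply: eq_bigr => b _; rewrite ffunE mulrDr mulrDr.
Qed.

HB.instance Definition _ := GRing.Zmodule_isPzRing.Build freeB
  freeB_mulA freeB_mul1r freeB_mulr1 freeB_mulDl freeB_mulDr.

Definition Bideal (M : freeB) : Prop :=
  forall a b : Pset A, gen_ideal (Brel (sval a) (sval b)) (M (a, b)).

Definition Bideal_pred : freeB -> bool := fun M => `[< Bideal M >].

Lemma Bideal_zmod : zmod_closed Bideal_pred.
Proof.
split; first by apply/asboolP => a b; rewrite ffunE; apply: gen_ideal0.
move=> M N /asboolP hM /asboolP hN; apply/asboolP => a b; rewrite !ffunE.
by apply: gen_idealD => //; apply: gen_idealN.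
Qed.
HB.instance Definition _ := GRing.isZmodClosed.Build freeB Bideal_pred Bideal_zmod.

Lemma umonU T1 T2 : umon T1 * umon T2 = umon (T1 :&: T2)%SET * umon (T1 :|: T2)%SET.
Proof.
rewrite !umonE -!big_split /=; apply: eq_bigr => i _; rewrite !inE.
by case: (i \in T1); case: (i \in T2); rewrite /= ?mul1r ?mulr1.
Qed.

Lemma Tset_Delta a b c x : Delta A a x -> Delta A c x ->
  (forall i, i \in Tset a b c -> x 0 i = 0) -> Delta A b x.
Proof.
move=> [Vx ha] [_ hc] h; split => // i.
have [<-|ne] := eqVneq (a i) (b i); first exact: ha.
have [e|ne'] := eqVneq (a i) (c i); first by rewrite h ?mulr0 // inE e eqxx -e.
have -> : b i = c i by move: ne ne'; case: (a i) (b i) (c i) => [] [] [].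
exact: hc.
Qed.

Lemma Brel_closed a b c m1 m2 :
  (Brel a b m1 -> gen_ideal (Brel a c) (umon (Tset a b c) * m1 * m2)) /\
  (Brel b c m1 -> gen_ideal (Brel a c) (umon (Tset a b c) * m1 * m2)).
Proof.
have key T : (forall x, Delta A a x -> Delta A c x -> Hflat A (Tset a b c :|: T)%SET x -> False) ->
    gen_ideal (Brel a c) (umon (Tset a b c) * umon T * m2).
  move=> h; apply: gen_idealMr; rewrite umonU; apply: gen_idealMl.
  apply: gen_ideal_mem; exists (Tset a b c :|: T)%SET => //.
  by apply/seteqP; split => x // [[h1 h2] h3]; apply: (h x).
split=> -[T hT ->]; apply: key => x hax hcx [Vx h].
  have: (Delta A a `&` Delta A b `&` Hflat A T)%classic x.
    split; last by split=> // i iT; apply: h; rewrite inE iT orbT.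
    split=> //; apply: (Tset_Delta hax hcx) => i iT; apply: h.
    by rewrite inE iT.
  by rewrite hT.
have: (Delta A b `&` Delta A c `&` Hflat A T)%classic x.
  split; last by split=> // i iT; apply: h; rewrite inE iT orbT.
  split=> //; apply: (Tset_Delta hax hcx) => i iT; apply: h.
  by rewrite inE iT.
by rewrite hT.
Qed.

Lemma gen_ideal_lift (X Y : Fu -> Prop) u w :
  (forall r m2, X r -> gen_ideal Y (u * r * m2)) ->
  gen_ideal X w -> gen_ideal Y (u * w).
Proof.
move=> h; elim=> [|a r b v Xr _ IH]; first by rewrite mulr0; apply: gen_ideal0.
rewrite mulrDr; apply: gen_idealD => //.
by rewrite mulrA (mulrCA u) -!mulrA; apply: gen_idealMl; rewrite mulrA; apply: h.
Qed.

Lemma Bideal_Ml M N : N \in Bideal_pred -> M * N \in Bideal_pred.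
Proof.
move=> /asboolP hN; apply/asboolP => a c; rewrite ffunE /=.
apply: gen_ideal_sum => b _; rewrite [M _ * _]mulrC mulrA; apply: gen_idealMr.
apply: gen_ideal_lift (hN b c) => r m2 Xr.
by apply: (Brel_closed (sval a) (sval b) (sval c) r m2).2.
Qed.

Lemma Bideal_Mr M N : N \in Bideal_pred -> N * M \in Bideal_pred.
Proof.
move=> /asboolP hN; apply/asboolP => a c; rewrite ffunE /=.
apply: gen_ideal_sum => b _; rewrite mulrA; apply: gen_idealMr.
apply: gen_ideal_lift (hN a b) => r m2 Xr.
by apply: (Brel_closed (sval a) (sval b) (sval c) r m2).1.
Qed.

Definition Bideal2 : ideal2 freeB := Ideal2 Bideal_Ml Bideal_Mr.

Definition Btilde : pzRingType := rquot Bideal2.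
Definition Bpi (M : freeB) : Btilde := rpi Bideal2 M.

Definition fP (a b : Pset A) : Btilde := Bpi [ffun p => (p == (a, b))%:R].

(* f_ab, or zero if a or b is not in P *)
Definition fB (a b : signs n) : Btilde :=
  match insub a, insub b with
  | Some a', Some b' => fP a' b'
  | _, _ => 0
  end.

(* the element u_i, that is the sum of the u_i e_a *)
Definition uB (i : 'I_n) : Btilde := Bpi [ffun p => 'X_i *+ (p.1 == p.2)].

Lemma fP_idem a : fP a a * fP a a = fP a a.
Proof.
rewrite /fP /Bpi -rpi_mul; apply: congr1; apply/ffunP => -[b c].
rewrite ffunE /= (bigD1 a) //= big1 ?addr0; last first.
  by move=> d /negbTE ne; rewrite !ffunE !xpair_eqE ne andbF mul0r mulr0.
rewrite !ffunE !xpair_eqE eqxx andbT.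
by case: eqP => [->|_]; rewrite ?umon0 ?mul1r ?mul0r ?mulr0.
Qed.

Lemma fB_idem a : fB a a * fB a a = fB a a.
Proof.
by rewrite /fB; case: (insub a) => [b|]; rewrite ?fP_idem ?mul0r.
Qed.

(* e_a, or zero if a is not in P *)
Definition eB (a : signs n) : idem Btilde := Idem (fB_idem a).

End ConvolutionAlgebra.

Section Resolution.
Variables (R : realType) (n : nat) (A : arrangement R n).
Variables (a : signs n) (S : {set 'I_n}).

Definition subC : Type := {T : {set 'I_n} | T \subset (~: S)%SET}.
HB.instance Definition _ := SubFinite.on subC.

(* For S = x_a. The summand of T is zero if flip a (sval T) is not in P. *)
Definition resol : lmodType (Btilde A) :=
  dsum (fun T : subC => eB A (flip a (sval T))).

Definition dresol : resol -> resol :=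
  @right_mult (Btilde A) subC (fun T => eB A (flip a (sval T))) (fun T T' =>
    \sum_(i in sval T | sval T' == (sval T :\ i)%SET)
       fB A (flip a (sval T)) (flip a (sval T'))).

End Resolution.

Section Comparison.
Variables (R : realType) (n k : nat) (A : arrangement R n).

Definition OS_iso (phi : Btilde A -> Bl n k) : Prop :=
  [/\ bijective phi,
      forall b y, corr A b y -> phi (fB A b b) = ival (lI k y),
      forall i, phi (uB A i) = lU k i
    & forall b b' y y' i, corr A b y -> corr A b' y' -> b' = flip b [set i]%SET ->
        (Rrel i y y' -> phi (fB A b b') = lR k i y y') /\
        (Rrel i y' y -> phi (fB A b b') = lL k i y y')].

End Comparison.

(* Main.v *)
Require Import Defs.
From mathcomp Require Import all_boot all_order all_algebra.
From mathcomp Require Import fingroup perm.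
From mathcomp Require Import boolp classical_sets reals.

Set Implicit Arguments.
Unset Strict Implicit.
Unset Printing Implicit Defensive.

Import Order.TTheory GRing.Theory Num.Theory.

Local Open Scope ring_scope.

(** Indices run from [0]. Write [below X m] for the number of elements of [X]
    smaller than [m]. A sign vector is determined by the set [X] of the indices
    at which its sign changes, the first entry being compared with a plus sign
    placed in front of it; [alternate X] is the sign vector with that set of
    changes.

    Left cyclicity makes the arrangement explicit: [alternate X] lies in P
    exactly when [X] has [k] elements, and then its optimal vertex is [H_X]
    ([inP_alternate], [alternate_in], [xset_alternate], summed up in [corrP]).
    Three facts about total positivity give this.
    - Given [k - 1] indices, the graph of [xi] on [V] contains a vector that
      vanishes there, alternates in sign across them and has positive
      [xi]-coordinate ([V_sign_pattern]). Dually this gives the signs of the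
      coefficients of [xi] in the coordinates [x_i], [i] in [X], so it decides
      on which cones [xi] is bounded and where it is maximal ([xiV_le0]). If a
      sign vector has fewer than [k] changes, it also gives a ray along which
      [xi] is unbounded ([V_weak_sign_pattern]).
    - A vector of [V_eta] cannot have the signs -, +, -, and so on, even
      weakly, at [k + 1] increasing indices ([V_eta_alternates]). Hence no sign
      vector with more than [k] changes has a nonempty chamber. The signs of
      the coordinates of the vertex [H_X] follow as well ([vertex_signs]).
    - The second fact would hold with all signs reversed for the opposite of
      [eta], which spans the same space together with [V]. The orthogonal
      projection of [eta] decides between the two: its first coordinate is
      positive, and it has at least [k] sign changes, because [V] contains
      vectors of every sign pattern with fewer changes ([proj_alternates]).

    On the side of the diagram, a generator [g] is given by the set [raised g]
    of the blue circles on which it uses the second of the two bottom arcs.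
    Counting the occupied arcs below a bound shows that flipping the entries of
    [alternate S] in [raised g] gives [alternate] of the set of unoccupied arcs
    ([alternate_unoccupied]), so [g] belongs to the summand of [raised g] in
    the resolution. A second count shows that every other summand vanishes
    ([gen_of_flip]). A bigon on the circle [j] removes [j] from the raised set
    and moves the free arc from [j] to [j + 1], so it is the component of the
    differential of the resolution that drops [j] ([bigonP], [bigon_Rrel]); its
    coefficient, the arrow [R_j], is the image of the element [f] of the two
    chambers, which differ in entry [j] only. *)

(** * Counting the elements of a set of indices below a bound *)

Definition below n (X : {set 'I_n}) (m : nat) : nat :=
  #|[set x in X | (x < m)%N]|.

Lemma below0 n (X : {set 'I_n}) : below X 0 = 0%N.
Proof. by apply/eqP; rewrite cards_eq0; apply/eqP/setP => x; rewrite !inE andbF. Qed.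

Lemma belowS n (X : {set 'I_n}) (i : 'I_n) :
  below X i.+1 = (below X i + (i \in X))%N.
Proof.
rewrite /below (cardsD1 i) !inE ltnSn andbT addnC; congr (_ + _)%N.
by apply: eq_card => x; rewrite !inE ltnS [(x < i)%N]ltn_neqAle andbCA.
Qed.

Lemma below_full n (X : {set 'I_n}) : below X n = #|X|.
Proof. by apply: eq_card => x; rewrite !inE ltn_ord andbT. Qed.

Lemma below_mono n (X : {set 'I_n}) (m m' : nat) :
  (m <= m')%N -> (below X m <= below X m')%N.
Proof.
move=> le; apply/subset_leq_card/fintype.subsetP => x; rewrite !inE.
by case: (x \in X) => //= h; apply: leq_trans le.
Qed.

Lemma below_lt n (X : {set 'I_n}) (i : 'I_n) (m : nat) :
  i \in X -> (below X i < below X m)%N = (i < m)%N.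
Proof.
move=> iX; case: (ltnP i m) => h.
  by apply: leq_trans (below_mono X h); rewrite belowS iX addn1.
by apply/negbTE; rewrite -leqNgt below_mono.
Qed.

Lemma below_inj n (X : {set 'I_n}) (i j : 'I_n) :
  i \in X -> j \in X -> below X i = below X j -> i = j.
Proof.
move=> iX jX e; apply/val_inj; case: (ltngtP i j) => //.
  by rewrite -(below_lt j iX) e ltnn.
by rewrite -(below_lt i jX) e ltnn.
Qed.

Lemma below_bound n (X : {set 'I_n}) (i : 'I_n) : i \in X -> (below X i < #|X|)%N.
Proof. by move=> iX; rewrite -below_full below_lt. Qed.

(** The map [below X] is a bijection from [X] to the ordinals below its
    cardinal, and its inverse enumerates [X] in increasing order. *)
Lemma incr_enum n k (X : {set 'I_n}) : (k <= #|X|)%N ->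
  exists f : 'I_k -> 'I_n,
    [/\ {homo f : i j / (i < j)%N}, forall r, f r \in X
      & forall r, below X (f r) = r].
Proof.
move=> kX.
have ex (r : 'I_k) : {i : 'I_n | (i \in X) && (below X i == r)}.
  apply: sigW.
  pose F (i : {i | i \in X}) : 'I_#|X| := Ordinal (below_bound (valP i)).
  have Finj : injective F.
    by move=> i j /(congr1 val)/= /(below_inj (valP i) (valP j))/val_inj.
  have le : (#|'I_#|X| | <= #|{: {i | i \in X}}|)%N.
    by rewrite card_ord card_sig; apply/eq_leq/eq_card.
  have /codomP[i e] := inj_card_onto Finj le (widen_ord kX r).
  move/(congr1 val): e => /= e.
  by exists (val i); rewrite (valP i) -e eqxx.
exists (fun r => sval (ex r)); split.
- move=> i j ij; case: (ex i) => a /= /andP[aX /eqP ea].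
  by case: (ex j) => b /= /andP[bX /eqP eb]; rewrite -(below_lt b aX) ea eb.
- by move=> r; case: (ex r) => a /= /andP[].
- by move=> r; case: (ex r) => a /= /andP[_ /eqP].
Qed.

(** * Vectors with prescribed zeros and signs *)

(** Putting [j] first ([t = 0]) makes determinants linear in the column [j] at a
    fixed place; putting it at its rank makes the sequence increasing. *)
Definition insert_at k m (t : 'I_k.+1) (g : 'I_k -> 'I_m) (j : 'I_m)
  (i : 'I_k.+1) : 'I_m := if unlift t i is Some r then g r else j.

Lemma insert_at_incr k m (Z : {set 'I_m}) (g : 'I_k -> 'I_m) (j : 'I_m)
    (t : 'I_k.+1) :
  {homo g : i i' / (i < i')%N} -> (forall r, g r \in Z) ->
  (forall r, below Z (g r) = r) -> j \notin Z -> below Z j = t ->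
  {homo insert_at t g j : i i' / (i < i')%N}.
Proof.
move=> gi gZ gb jZ tE i i'; rewrite /insert_at.
case: unliftP => [r ->|->]; case: unliftP => [r' ->|->]; rewrite /= ?ltnn //.
- by rewrite ltnNge leq_bump2 -ltnNge; apply: gi.
- rewrite /bump -(below_lt j (gZ r)) gb tE.
  by case: (leqP t r) => //= h; rewrite add1n => /ltnW; rewrite ltnNge h.
- rewrite /bump; case: (leqP t r') => [h _|h] /=; last by rewrite add0n ltnNge ltnW.
  rewrite ltn_neqAle; apply/andP; split.
    by apply: contra jZ => /eqP/val_inj ->.
  by rewrite leqNgt -(below_lt j (gZ r')) gb tE -leqNgt.
Qed.

(** The two sequences differ by a cycle of length [t + 1]. *)
Lemma det_insert_at (R : comPzRingType) k m (B : 'M[R]_(k.+1, m))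
    (g : 'I_k -> 'I_m) (j : 'I_m) (t : 'I_k.+1) :
  \det (colsub (insert_at ord0 g j) B) =
    (-1) ^+ t * \det (colsub (insert_at t g j) B).
Proof.
pose s : 'S_k.+1 := lift_perm ord0 t 1%g.
have -> : colsub (insert_at ord0 g j) B = col_perm s (colsub (insert_at t g j) B).
  apply/matrixP => a b; rewrite !mxE /insert_at.
  case: unliftP => [r ->|->]; first by rewrite lift_perm_lift perm1 liftK.
  by rewrite lift_perm_id unlift_none.
rewrite col_permE det_mulmx det_perm odd_permV odd_lift_perm odd_perm1 /=.
by rewrite addbF signr_odd mulrC.
Qed.

Definition minors_same_sign (R : numDomainType) k m (B : 'M[R]_(k, m)) : Prop :=
  forall f g : 'I_k -> 'I_m,
    {homo f : i j / (i < j)%N} -> {homo g : i j / (i < j)%N} ->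
    0 < \det (colsub f B) * \det (colsub g B).

(** The vector has the entries [det (B_j | B_Z)]. Expanding along the column
    [B_j] shows that it is a combination of the rows of [B]; it vanishes on [Z]
    because of the repeated column; and sorting the columns costs one sign for
    each element of [Z] below [j]. *)
Lemma sign_pattern (R : realFieldType) k m (B : 'M[R]_(k.+1, m))
    (Z : {set 'I_m}) :
  minors_same_sign B -> #|Z| = k ->
  exists c : 'rV_k.+1,
    (forall z, z \in Z -> (c *m B) 0 z = 0) /\
    (forall j, j \notin Z -> 0 < (-1) ^+ below Z j * (c *m B) 0 j).
Proof.
move=> Bpos cZ.
have [g [gi gZ gb]] := @incr_enum m k Z (eq_leq (esym cZ)).
have [j0 j0Z|full] := pickP (fun j => j \notin Z); last first.
  by exists 0; split => [z _|j]; [rewrite mul0mx mxE | rewrite full].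
have pos (j : 'I_m) : (below Z j < k.+1)%N by rewrite ltnS -cZ -below_full below_mono // ltnW.
have incr j : j \notin Z -> {homo insert_at (Ordinal (pos j)) g j : i i' / (i < i')%N}.
  by move=> jZ; apply: insert_at_incr gi gZ gb jZ _.
(* The factor d0 turns the common sign of the minors into plus. *)
pose d0 := \det (colsub (insert_at (Ordinal (pos j0)) g j0) B).
pose u j := \det (colsub (insert_at ord0 g j) B).
pose c : 'rV[R]_k.+1 := \row_i (d0 * cofactor (colsub (insert_at ord0 g j0) B) i 0).
have uE j : (c *m B) 0 j = d0 * u j.
  rewrite mxE /u (expand_det_col _ 0) mulr_sumr; apply: eq_bigr => i _.
  rewrite !mxE /insert_at unlift_none [B i j * _]mulrC mulrA.
  rewrite /cofactor !mulrA; congr (_ * \det _ * _).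
  by apply/matrixP => a b; rewrite !mxE liftK.
exists c; split=> [z zZ|j jZ]; rewrite uE /u.
  have [r rE] : exists r, g r = z.
    have zk : (below Z z < k)%N by rewrite -cZ below_bound.
    by exists (Ordinal zk); apply: (below_inj (gZ _) zZ); rewrite gb.
  rewrite -det_tr (@determinant_alternate _ _ _ 0 (lift 0 r)) ?mulr0 //.
  by move=> a; rewrite !mxE /insert_at liftK unlift_none rE.
rewrite (det_insert_at _ _ _ (Ordinal (pos j))) /= mulrCA signrMK.
by apply: Bpos; apply: incr.
Qed.

(** Padding [X] with the largest indices outside [X] adds zeros, but no sign
    change, to the vector of [sign_pattern]. *)
Lemma pad_top k m (X : {set 'I_m.+1}) :
  ord0 \notin X -> (#|X| <= k)%N -> (k <= m)%N ->
  exists Z : {set 'I_m.+1}, [/\ ord0 \notin Z, #|Z| = k, X \subset Z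
    & forall j, j \notin Z -> below Z j = below X j].
Proof.
move=> + + km; elim: {X}(k - #|X|)%N {-2}X (erefl (k - #|X|)%N) => [|d IH] X dE X0 Xk.
  exists X; split => //; apply/eqP; rewrite eqn_leq Xk /=.
  by move/eqP: dE; rewrite subn_eq0.
have ltX : (#|X| < k)%N by rewrite -subn_gt0 dE.
have [e eX] : exists e, e \in ~: (ord0 |: X).
  apply/finset.set0Pn; rewrite -card_gt0 cardsCs finset.setCK card_ord cardsU1 X0 subn_gt0 add1n.
  by rewrite ltnS (leq_trans ltX).
have [t tX tmax] := arg_maxnP (fun t : 'I_m.+1 => t : nat) eX.
have {tX} [t0 tX] : t != ord0 /\ t \notin X.
  by apply/andP; rewrite -negb_or; have := tX : t \in ~: (ord0 |: X); rewrite !inE.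
have ct : #|t |: X| = #|X|.+1 by rewrite cardsU1 tX.
have [|||Z [Z0 cZ sZ bZ]] := IH (t |: X).
- by rewrite ct subnS dE.
- by rewrite !inE negb_or eq_sym t0.
- by rewrite ct.
exists Z; split => // [|j jZ]; first exact: fintype.subset_trans (finset.subsetUr _ _) sZ.
have jtX : j \notin t |: X by apply: contra jZ; apply: (fintype.subsetP sZ).
rewrite bZ //; apply: eq_card => x; rewrite !inE.
have [->|//] := eqVneq x t; rewrite /= (negbTE tX) /=.
apply/negbTE; rewrite -leqNgt; have [->//|j0] := eqVneq j ord0.
apply: tmax; rewrite -[_ j]/(j \in ~: (ord0 |: X)) !inE negb_or j0.
by move: jtX; rewrite !inE negb_or => /andP[].
Qed.

(** A sign vector that starts with plus and has at most [k] changes is realized,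
    up to zeros, by a combination of the rows. *)
Lemma weak_sign_pattern (R : realFieldType) k m (B : 'M[R]_(k.+1, m.+1))
    (X : {set 'I_m.+1}) :
  minors_same_sign B -> (k <= m)%N -> ord0 \notin X -> (#|X| <= k)%N ->
  exists c : 'rV_k.+1,
    0 < (c *m B) 0 ord0 /\
    forall j : 'I_m.+1, 0 <= (-1) ^+ below X j.+1 * (c *m B) 0 j.
Proof.
move=> Bpos km X0 Xk; have [Z [Z0 cZ sZ bZ]] := pad_top X0 Xk km.
have [c [c0 cs]] := sign_pattern Bpos cZ.
exists c; split; first by have := cs _ Z0; rewrite below0 mul1r.
move=> j; have [jZ|jZ] := boolP (j \in Z); first by rewrite c0 // mulr0.
have jX : j \notin X by apply: contra jZ; apply: (fintype.subsetP sZ).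
by rewrite belowS (negbTE jX) addn0 -bZ // ltW // cs.
Qed.

(** * Sign vectors as sets of sign changes *)

Definition alternate n (X : {set 'I_n}) : {ffun 'I_n -> bool} :=
  [ffun i : 'I_n => odd (below X i.+1)].

(** The parities of [below X] up to [i] and up to [i + 1] decide whether [i] is
    in [X]. *)
Lemma alternate_inj n : injective (@alternate n).
Proof.
move=> X Y /ffunP e.
have par (m : nat) : (m <= n)%N -> odd (below X m) = odd (below Y m).
  case: m => [|m] mn; first by rewrite !below0.
  by have := e (Ordinal mn); rewrite !ffunE.
apply/setP => i; have := par i.+1 (ltn_ord i).
rewrite !belowS !oddD (par i (ltnW (ltn_ord i))) => /addbI.
by case: (i \in X); case: (i \in Y).
Qed.

Lemma alternate_onto n (b : {ffun 'I_n -> bool}) : exists X, b = alternate X.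
Proof.
have := inj_card_onto (@alternate_inj n).
rewrite card_ffun card_bool card_ord -cardsT -finset.powersetT card_powerset cardsT card_ord.
by move=> /(_ (leqnn _) b) /codomP.
Qed.

(** * Sign vectors of a left cyclic arrangement *)

Lemma below_lift n (X : {set 'I_n}) (m : nat) :
  below [set lift ord0 x | x in X] m.+1 = below X m.
Proof.
rewrite /below -[RHS](card_imset _ (@lift_inj _ ord0)); apply: eq_card => y.
rewrite inE; apply/andP/imsetP => [[/imsetP[x xX ->] h]|[x]].
  by exists x => //; rewrite inE xX.
by rewrite inE => /andP[xX h] ->; split; [apply: imset_f | ].
Qed.

Lemma colsub_mul (R : pzRingType) m k n l (M : 'M[R]_(m, k)) (C : 'M[R]_(k, n))
    (f : 'I_l -> 'I_n) : colsub f (M *m C) = M *m colsub f C.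
Proof. by apply/matrixP => i j; rewrite !mxE; apply: eq_bigr => s _; rewrite mxE. Qed.

Lemma mul_col'0 (R : pzRingType) m k n (M : 'M[R]_(m, k)) (C : 'M[R]_(k, n.+1)) i j :
  (M *m col' ord0 C) i j = (M *m C) i (lift ord0 j).
Proof. by rewrite !mxE; apply: eq_bigr => s _; rewrite mxE. Qed.

Lemma minors_col'0 (R : numDomainType) k n (B : 'M[R]_(k, n.+1)) :
  minors_same_sign B -> minors_same_sign (col' ord0 B).
Proof.
move=> Bpos f g fi gi.
have colE (h : 'I_k -> 'I_n) : colsub h (col' ord0 B) = colsub (lift ord0 \o h) B.
  by apply/matrixP => i j; rewrite !mxE.
rewrite !colE; apply: Bpos => i j ij /=; rewrite /bump /= !add1n ltnS; [exact: fi|exact: gi].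
Qed.

Lemma lift0_rshift n (i : 'I_n) : lift ord0 i = rshift 1 i :> 'I_(1 + n).
Proof. exact: val_inj. Qed.

Lemma det_colsub_col_mx (R : comPzRingType) k n (x : 'rV[R]_n) (B : 'M[R]_(k, n))
    (f : 'I_k.+1 -> 'I_n) :
  \det (colsub f (col_mx x B)) =
  \sum_(r < k.+1) (-1) ^+ r * x 0 (f r) * \det (colsub (f \o lift r) B).
Proof.
rewrite (expand_det_row _ (ord0 : 'I_k.+1)); apply: eq_bigr => r _.
rewrite mxE (_ : ord0 = lshift k ord0 :> 'I_(1 + k)) ?col_mxEu; last exact: val_inj.
rewrite /cofactor mulrCA mulrA; congr (_ * _ * \det _).
apply/matrixP => i j; rewrite [RHS]mxE -(col_mxEd x B) [LHS]mxE mxE mxE.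
by congr (col_mx _ _ _ _); apply: val_inj.
Qed.

Section LeftCyclic.
Variables (R : realType) (n k : nat) (A : arrangement R n).
Hypotheses (kn : (k <= n)%N) (pol : polarized A k) (cyc : left_cyclic A k).
Local Notation V := (arrV A).

Let dimV : \dim V = k. Proof. by case: pol. Qed.

Lemma xiVP c u v : xiV A (c *: u + v) = c * xiV A u + xiV A v.
Proof. by rewrite /xiV !linearP. Qed.

Lemma xiV0 : xiV A 0 = 0.
Proof. by rewrite /xiV !linear0. Qed.

Lemma xiV_sum (I : finType) (P : pred I) (c : I -> R) (v : I -> 'rV[R]_n) :
  xiV A (\sum_(i | P i) c i *: v i) = \sum_(i | P i) c i * xiV A (v i).
Proof.
elim/big_rec2: _ => [|i x y _ <-]; first exact: xiV0.
exact: xiVP.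
Qed.

(** A basis of the graph of [xi] restricts to a basis of [V] with minors of one
    sign, the column [0] of the graph holding the values of [xi]. *)
Lemma V_param : exists B : 'M[R]_(k, n.+1),
  [/\ minors_same_sign B,
      forall c, c *m col' ord0 B \in V /\ xiV A (c *m col' ord0 B) = (c *m B) 0 ord0
    & forall v, v \in V -> exists c, v = c *m col' ord0 B].
Proof.
case: cyc => -[B [_ BW Bpos]] _; exists B; split => // [c|v vV].
  have /BW[v vV e] : (c *m B <= B)%MS by apply: submxMl.
  have cv : c *m col' ord0 B = v.
    apply/rowP => j; rewrite mul_col'0 e lift0_rshift.
    exact: (@row_mxEr _ 1 1 n).
  rewrite cv e; split => //.
  rewrite (_ : ord0 = lshift n ord0 :> 'I_(1 + n)); last exact: val_inj.
  by rewrite (@row_mxEl _ 1 1 n) mxE.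
have /submxP[c e] := (BW _).1 (ex_intro2 _ _ v vV erefl).
exists c; apply/rowP => j; rewrite mul_col'0 -e lift0_rshift.
by rewrite (@row_mxEr _ 1 1 n).
Qed.

Lemma V_sign_pattern (Z : {set 'I_n}) : #|Z|.+1 = k ->
  exists v, [/\ v \in V, 0 < xiV A v, forall z, z \in Z -> v 0 z = 0
    & forall j, j \notin Z -> 0 < (-1) ^+ below Z j * v 0 j].
Proof.
move=> cZ; have [B [Bpos BV _]] := V_param.
move: B Bpos BV; rewrite -cZ => B Bpos BV.
have cZ' : #|[set lift ord0 x | x in Z]| = #|Z| by apply: card_imset; apply: lift_inj.
have [c [c0 cs]] := sign_pattern Bpos cZ'.
have [vV xE] := BV c; exists (c *m col' ord0 B); split => //.
- have /cs : ord0 \notin [set lift ord0 x | x in Z].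
    by apply/imsetP => -[x _] /(congr1 val).
  by rewrite below0 mul1r xE.
- by move=> z zZ; rewrite mul_col'0 c0 // imset_f.
- move=> j jZ; have := cs (lift ord0 j).
  rewrite mem_imset; last exact: lift_inj.
  by move=> /(_ jZ); rewrite mul_col'0 /= {1}/bump /= add1n below_lift.
Qed.

Lemma V_weak_sign_pattern (X : {set 'I_n}) : (#|X| < k)%N ->
  exists v, [/\ v \in V, 0 < xiV A v
    & forall j, 0 <= (-1) ^+ alternate X j * v 0 j].
Proof.
move=> Xk; have [B [Bpos BV _]] := V_param.
have [k' k'E] : exists k', k = k'.+1 by exists k.-1; rewrite (ltn_predK Xk).
move: B Bpos BV; rewrite k'E => B Bpos BV.
have cX : #|[set lift ord0 x | x in X]| = #|X| by apply: card_imset; apply: lift_inj.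
have X0 : ord0 \notin [set lift ord0 x | x in X].
  by apply/imsetP => -[x _] /(congr1 val).
have [|| c [c0 cs]] := weak_sign_pattern Bpos _ X0; first by rewrite ltnW // -k'E.
  by rewrite cX -ltnS -k'E.
have [vV xE] := BV c; exists (c *m col' ord0 B); split => //; first by rewrite xE.
move=> j; have := cs (lift ord0 j).
by rewrite mul_col'0 ffunE signr_odd /= {1}/bump /= add1n below_lift.
Qed.

(** The coordinates in a [k]-element set are coordinates on [V], because the
    corresponding minor is nonzero. *)
Lemma V_interpolation (X : {set 'I_n}) (w : 'rV[R]_n) : #|X| = k ->
  exists v, [/\ v \in V, forall i, i \in X -> v 0 i = w 0 i
    & forall v', v' \in V -> (forall i, i \in X -> v' 0 i = w 0 i) -> v' = v].
Proof.
move=> cX; have [f [fi fX fb]] := @incr_enum n k X (eq_leq (esym cX)).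
have fsurj i : i \in X -> exists r, f r = i.
  move=> iX; have ik : (below X i < k)%N by rewrite -cX below_bound.
  by exists (Ordinal ik); apply: (below_inj (fX _) iX); rewrite fb.
have [B [/minors_col'0 Bpos BV VB]] := V_param.
set C := col' ord0 B in Bpos BV VB.
have Cu : colsub f C \in unitmx.
  rewrite unitmxE unitfE; apply/eqP => e.
  by have := Bpos f f fi fi; rewrite e mul0r ltxx.
exists (colsub f w *m invmx (colsub f C) *m C); split.
- by case: (BV (colsub f w *m invmx (colsub f C))).
- move=> i /fsurj[r <-].
  have : colsub f (colsub f w *m invmx (colsub f C) *m C) 0 r = colsub f w 0 r.
    by rewrite colsub_mul mulmxKV.
  by rewrite !mxE.
move=> v' /VB[c ->] e; congr (_ *m _).
apply: (canRL (mulmxK Cu)); rewrite -colsub_mul; apply/rowP => r.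
by rewrite !mxE -e ?mxE.
Qed.

Lemma V_zero (X : {set 'I_n}) v : #|X| = k -> v \in V ->
  (forall i, i \in X -> v 0 i = 0) -> v = 0.
Proof.
move=> cX vV v0; have [u [_ _ uE]] := V_interpolation 0 cX.
rewrite (uE v) // => [|i iX]; last by rewrite v0 // mxE.
by rewrite [RHS]uE ?mem0v.
Qed.

Lemma lift_eta_sub x y : is_lift_eta A x -> (is_lift_eta A y <-> y - x \in V).
Proof.
rewrite /is_lift_eta => <-.
split => [e|h].
  have := Quotient.idealrBE (pred_of_vspace V) y x.
  by rewrite e eqxx => ->.
by apply/eqP; rewrite -Quotient.idealrBE.
Qed.

Lemma lift_eta_ex : exists x, is_lift_eta A x.
Proof. by exists (generic_quotient.repr (arr_eta A)); rewrite /is_lift_eta reprK. Qed.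

(** The rows span the same space as the given basis of the span of [V] and [eta],
    so the minors of the two differ by a common factor. *)
Lemma V_eta_minors x : (k < n)%N -> is_lift_eta A x ->
  forall B : 'M[R]_(k, n), (forall v, v \in V <-> (v <= B)%MS) ->
  minors_same_sign (col_mx x B : 'M_(k.+1, n)).
Proof.
move=> ltkn xl B VB; case: cyc => _ /(_ ltkn)[[C [Cfree CW Cpos]] _].
pose r := generic_quotient.repr (arr_eta A).
have rl : is_lift_eta A r by rewrite /is_lift_eta /r reprK.
have rx : r - x \in V by apply/(lift_eta_sub r xl).
have xr : x - r \in V by rewrite -opprB rpredN.
have WD w : w \in (V + <[r]>)%VS <-> (w <= col_mx x B)%MS.
  split=> [/memv_addP[u uV [_ /vlineP[c ->] ->]]|].
    have -> : u + c *: r = c *: x + (u + c *: (r - x)).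
      by rewrite scalerBr addrCA [c *: x + _]addrC subrK.
    apply: addmx_sub.
      by apply: scalemx_sub; rewrite -addsmxE addsmxSl.
    have /VB h : u + c *: (r - x) \in V by rewrite rpredD // rpredZ.
    by apply: submx_trans h _; rewrite -addsmxE addsmxSr.
  case/submxP => d ->; rewrite -[d]hsubmxK mul_row_col.
  rewrite [lsubmx d]mx11_scalar mul_scalar_mx; set c := lsubmx d 0 0.
  have -> : c *: x + rsubmx d *m B = (c *: (x - r) + rsubmx d *m B) + c *: r.
    by rewrite scalerBr addrAC subrK.
  apply: memv_add; last by rewrite rpredZ // memv_line.
  by rewrite rpredD // ?rpredZ //; apply/VB/submxMl.
have /submxP[M ME] : (col_mx x B <= C)%MS.
  by apply/row_subP => i; apply/CW/WD; apply: row_sub.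
have /submxP[N NE] : (C <= col_mx x B)%MS.
  by apply/row_subP => i; apply/WD/CW; apply: row_sub.
have NM : N *m M = 1%:M.
  by apply: (row_free_inj Cfree); rewrite -mulmxA -ME -NE mul1mx.
have dM : \det M != 0.
  apply: contra_eq_neq (congr1 determinant NM) => e.
  by rewrite det_mulmx e mulr0 det1 eq_sym oner_neq0.
move=> f g fi gi; rewrite ME !colsub_mul !det_mulmx mulrACA -expr2.
by rewrite mulr_gt0 ?Cpos // exprn_even_gt0.
Qed.

(** If [p] had fewer than [k] sign changes, then [V] would contain a vector with
    the same weak signs and with positive first coordinate, which could not be
    orthogonal to [p]. *)
Lemma proj_alternates (p : 'rV[R]_n) : (k < n)%N ->
  (forall v, v \in V -> \sum_(i < n) v 0 i * p 0 i = 0) ->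
  (forall i : 'I_n, i = 0%N :> nat -> 0 < p 0 i) ->
  exists f : 'I_k.+1 -> 'I_n,
    {homo f : i j / (i < j)%N} /\ forall r : 'I_k.+1, 0 <= (-1) ^+ r * p 0 (f r).
Proof.
move=> ltkn pV p0.
have [B [/minors_col'0 Bpos BV VB]] := V_param; set C : 'M_(k, n) := col' ord0 B in Bpos BV VB.
have [m mE] : exists m, n = m.+1 by exists n.-1; rewrite (ltn_predK ltkn).
(* Zero entries of p count as positive. *)
have [X XE] := alternate_onto [ffun i => p 0 i < 0].
have abs_p j : (-1) ^+ alternate X j * p 0 j = `|p 0 j|.
  by rewrite -XE ffunE -normrEsign.
have [z z0] : exists z : 'I_n, z = 0%N :> nat.
  by exists (Ordinal (leq_ltn_trans (leq0n k) ltkn)).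
have zX : z \notin X.
  have := congr1 (fun h : {ffun _} => h z) XE.
  rewrite !ffunE belowS z0 below0 add0n ltNge ltW ?p0 //=.
  by case: (z \in X).
case: (ltnP #|X| k) => [Xk|kX].
  exfalso; have [k' k'E] : exists k', k = k'.+1 by exists k.-1; rewrite (ltn_predK Xk).
  have [c [c0 cs]] : exists c : 'rV_k, 0 < (c *m C) 0 z /\
      forall j : 'I_n, 0 <= (-1) ^+ below X j.+1 * (c *m C) 0 j.
    move: (C) Bpos (X) zX Xk (ltkn); rewrite k'E.
    move: z z0; rewrite mE => z z0 D Dpos Y Y0 Yk lt.
    have zE : z = ord0 by apply: val_inj.
    rewrite zE in Y0 *.
    exact: (weak_sign_pattern Dpos (ltnW lt) Y0 Yk).
  have /pV : c *m C \in V by case: (BV c).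
  apply/eqP; rewrite gt_eqF // (bigD1 z) //= ltr_wpDr //.
    apply: sumr_ge0 => i _; have := mulr_ge0 (cs i) (normr_ge0 (p 0 i)).
    by rewrite -abs_p ffunE signr_odd mulrACA -expr2 sqrr_sign mul1r.
  by rewrite mulr_gt0 // p0.
have [f [fi fX fb]] := incr_enum kX.
(* Index 0 together with the first k sign changes of p. *)
exists (insert_at ord0 f z); split.
  apply: (@insert_at_incr _ _ [set f r | r : 'I_k] f z ord0) => //.
  - by move=> r; apply: imset_f.
  - move=> r; rewrite /below.
    have -> : [set x in [set f r | r : 'I_k] | (x < f r)%N] = [set f s | s : 'I_k & (s < r)%N].
      apply/setP => x; rewrite !inE; apply/andP/imsetP => [[/imsetP[s _ ->]]|[s]].
        by rewrite -(below_lt _ (fX s)) !fb => h; exists s; rewrite ?inE.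
      by rewrite inE => h ->; rewrite imset_f ?inE ?fi.
    rewrite card_imset; last first.
      by move=> s t e; apply: val_inj; rewrite /= -(fb s) -(fb t) e.
    by rewrite -sum1dep_card (big_ord_narrow (ltnW (ltn_ord r))) sum1_card card_ord.
  - by apply: contra zX => /imsetP[r _ ->].
  - by rewrite z0 below0.
move=> r; rewrite /insert_at; case: unliftP => [s ->|->]; last first.
  by rewrite mul1r ltW // p0.
have := abs_p (f s); rewrite ffunE signr_odd belowS fX fb addn1 => e.
by rewrite /= /bump /= add1n e.
Qed.

(** Expand the minor of the matrix with first row [x] and the rows of [V] below
    it along [x]. Its sign does not depend on the columns, nor on the choice
    of [x] in [V_eta]; the choice of the projection of [eta] and of the columns
    of [proj_alternates] shows that it is the sign of the minors of [V]. So the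
    terms of the expansion cannot all be nonpositive after dividing by it. *)
Lemma V_eta_alternates x (f : 'I_k.+1 -> 'I_n) : is_lift_eta A x ->
  {homo f : i j / (i < j)%N} -> exists r : 'I_k.+1, 0 < (-1) ^+ r * x 0 (f r).
Proof.
move=> xl fi.
have ltkn : (k < n)%N.
  have finj : injective f.
    move=> i j e; apply: val_inj; case: (ltngtP i j) => // /fi; by rewrite e ltnn.
  by have := leq_card f finj; rewrite !card_ord.
have [B [Bpos0 BV VB0]] := V_param; set C : 'M_(k, n) := col' ord0 B in BV VB0.
have Bpos : minors_same_sign C by apply: minors_col'0.
have VB v : v \in V <-> (v <= C)%MS.
  split=> [/VB0[c ->]|/submxP[c ->]]; first exact: submxMl.
  by case: (BV c).
have [_ /(_ ltkn)[_ [y [p [yl [yp pV] p0]]]]] := cyc.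
have pl : is_lift_eta A p by apply/(lift_eta_sub p yl); rewrite -opprB rpredN.
have [g [gi gs]] := proj_alternates ltkn pV p0.
have lift_incr (h : 'I_k.+1 -> 'I_n) (r : 'I_k.+1) : {homo h : i j / (i < j)%N} ->
    {homo h \o lift r : i j / (i < j)%N}.
  by move=> hi i j ij; apply: hi; rewrite /= ltnNge leq_bump2 -ltnNge.
(* Multiplying by d0 makes the minors of V positive. *)
pose d0 := \det (colsub (g \o lift 0) C).
pose E (w : 'rV[R]_n) (h : 'I_k.+1 -> 'I_n) := \det (colsub h (col_mx w C : 'M_(k.+1, n))).
have dE w h : d0 * E w h =
    \sum_(r < k.+1) (-1) ^+ r * w 0 (h r) * (d0 * \det (colsub (h \o lift r) C)).
  rewrite /E det_colsub_col_mx mulr_sumr; apply: eq_bigr => r _.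
  by rewrite mulrCA.
have d0pos (h : 'I_k.+1 -> 'I_n) (r : 'I_k.+1) :
  {homo h : i j / (i < j)%N} -> 0 < d0 * \det (colsub (h \o lift r) C).
  by move=> hi; apply: Bpos; apply: lift_incr.
have Epos := V_eta_minors ltkn pl VB.
have Eg : 0 < d0 * E p g.
  rewrite lt_def; apply/andP; split.
    have := Bpos _ _ (lift_incr _ 0 gi) (lift_incr _ 0 gi).
    have := Epos _ _ gi gi; rewrite -!expr2 !exprn_even_gt0 //= => h1 h2.
    by rewrite mulf_neq0.
  rewrite dE sumr_ge0 // => r _; rewrite mulr_ge0 //.
  by rewrite ltW // d0pos.
have Ef : 0 < d0 * E x f.
  have -> : E x f = E p f.
    have /VB0[c cE] : x - p \in V by apply/(lift_eta_sub x pl).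
    have e : col_mx x C = block_mx 1%:M c 0 1%:M *m col_mx p C.
      by rewrite mul_block_col !mul1mx mul0mx add0r -cE addrC subrK.
    by rewrite /E e colsub_mul det_mulmx (@det_ublock _ 1 k) !det1 !mul1r.
  have := mulr_gt0 Eg (Epos _ _ fi gi); rewrite -/(E p f) -/(E p g) => h.
  have : 0 < (d0 * E p f) * (E p g) ^+ 2.
    by move: h; congr (0 < _); rewrite expr2 mulrACA mulrA.
  by rewrite pmulr_lgt0 // exprn_even_gt0 //=; apply: contraTneq Eg => ->; rewrite mulr0 ltxx.
apply/existsP; apply: contraLR Ef => /existsPn ge.
rewrite -leNgt dE; apply: sumr_le0 => r _; rewrite mulr_le0_ge0 //.
  by rewrite leNgt ge.
by rewrite ltW // d0pos.
Qed.

(** Apply [V_eta_alternates] to [X] together with [j]: the only nonzero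
    coordinate available is the one at [j]. *)
Lemma vertex_signs (X : {set 'I_n}) : #|X| = k ->
  exists p, Hflat A X = [set p]%classic /\
    forall j, j \notin X -> 0 < (-1) ^+ alternate X j * p 0 j.
Proof.
move=> cX; have [x0 x0l] := lift_eta_ex.
have [v [vV vX _]] := V_interpolation x0 cX.
pose p := x0 - v.
have pl : is_lift_eta A p by apply/(lift_eta_sub p x0l); rewrite addrAC subrr add0r rpredN.
have pX i : i \in X -> p 0 i = 0 by move=> iX; rewrite !mxE vX ?subrr.
exists p; split.
  apply/seteqP; split => [q [ql qX]|q ->]; last by split.
  apply/eqP; rewrite -subr_eq0; apply/eqP/(V_zero cX).
    by apply/(lift_eta_sub q pl).
  by move=> i iX; rewrite !mxE qX // vX // subrr subr0.
move=> j jX.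
have cjX : #|j |: X| = k.+1 by rewrite cardsU1 jX cX.
have [f [fi fX fb]] := @incr_enum n k.+1 (j |: X) (eq_leq (esym cjX)).
have [r] := V_eta_alternates pl fi.
have [frX|frX] := boolP (f r \in X); first by rewrite pX // mulr0 ltxx.
have fj : f r = j by have := fX r; rewrite in_setU1 (negbTE frX) orbF => /eqP.
rewrite ffunE signr_odd belowS (negbTE jX) addn0 -(fb r) fj; congr (0 < _ ^+ _ * _).
by apply: eq_card => y; rewrite !inE; have [->|//] := eqVneq y j; rewrite ltnn !andbF.
Qed.

(** Expand [q] in the basis of [V] dual to the coordinates in [X]. The dual
    vectors are multiples of those of [V_sign_pattern] for [X] without one
    element, so the signs of [xi] on them are known, and every term of the
    resulting sum for [xi q] is nonpositive. *)
Lemma xiV_le0 (X : {set 'I_n}) (q : 'rV[R]_n) : #|X| = k -> q \in V ->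
  (forall i, i \in X -> 0 <= (-1) ^+ alternate X i * q 0 i) ->
  xiV A q <= 0 ?= iff (q == 0).
Proof.
move=> cX qV qX.
have dual i : exists v, i \in X -> [/\ v \in V, v 0 i = 1,
    forall j, j \in X -> j != i -> v 0 j = 0 & (-1) ^+ alternate X i * xiV A v < 0].
  have [iX|iX] := boolP (i \in X); last by exists 0.
  have cXi : #|X :\ i|.+1 = k by rewrite -cX (cardsD1 i X) iX.
  have [v [vV vx vZ vs]] := V_sign_pattern cXi.
  have bE : below (X :\ i) i = below X i.
    by apply: eq_card => y; rewrite !inE; have [->|//] := eqVneq y i; rewrite ltnn !andbF.
  have := vs i; rewrite !inE eqxx bE => /(_ isT) vi.
  have vi0 : v 0 i != 0 by apply: contraTneq vi => ->; rewrite mulr0 ltxx.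
  exists ((v 0 i)^-1 *: v) => _; split.
  - by rewrite rpredZ.
  - by rewrite mxE mulVf.
  - by move=> j jX ji; rewrite mxE (vZ j) ?mulr0 // !inE ji jX.
  rewrite -[_ *: v]addr0 xiVP xiV0 addr0 ffunE signr_odd belowS iX addn1.
  rewrite exprS mulN1r mulNr oppr_lt0 mulrA pmulr_lgt0 //.
  have -> : (-1) ^+ below X i / v 0 i = ((-1) ^+ below X i * v 0 i)^-1.
    by rewrite -signr_odd invfM invr_sign.
  by rewrite invr_gt0.
have [w wP] := choice dual.
have qE : q = \sum_(i in X) q 0 i *: w i.
  apply/eqP; rewrite -subr_eq0; apply/eqP/(V_zero cX).
    rewrite rpredB // rpred_sum // => i /wP[wV _ _ _]; exact: rpredZ.
  move=> j jX; rewrite !mxE summxE (bigD1 j) //= mxE.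
  have [_ -> _ _] := wP j jX.
  rewrite mulr1 big1 ?addr0 ?subrr // => i /andP[iX ij].
  by rewrite mxE; have [_ _ -> //] := wP i iX; rewrite ?mulr0 // eq_sym.
have term i : i \in X -> q 0 i * xiV A (w i) <= 0 ?= iff (q 0 i == 0).
  move=> iX; have [_ _ _ ws] := wP i iX; have := qX i iX.
  set e := (-1) ^+ _ in ws * => qs.
  have tE : q 0 i * xiV A (w i) = (e * q 0 i) * (e * xiV A (w i)).
    by rewrite mulrACA -expr2 sqrr_sign mul1r.
  split; first by rewrite tE mulr_ge0_le0 // ltW.
  by rewrite tE mulf_eq0 (lt_eqF ws) orbF mulf_eq0 signr_eq0.
have xE : xiV A q = \sum_(i in X) q 0 i * xiV A (w i) by rewrite {1}qE xiV_sum.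
split; first by rewrite xE; apply: sumr_le0 => i /term[].
apply/eqP/eqP => [x0|->]; last exact: xiV0.
apply: (V_zero cX qV) => i iX; apply/eqP; rewrite -(term i iX).2.
have : \sum_(i in X) - (q 0 i * xiV A (w i)) == 0 by rewrite sumrN -xE x0 oppr0.
rewrite psumr_eq0; last by move=> j /term[]; rewrite oppr_ge0.
by move/allP/(_ i (mem_index_enum _)); rewrite iX /= oppr_eq0.
Qed.

Lemma alternate_in (X : {set 'I_n}) : #|X| = k ->
  inP A (alternate X) /\ is_xset A (alternate X) X.
Proof.
move=> cX; have [p [HX ps]] := vertex_signs cX.
have [pl pX] : Hflat A X p by rewrite HX.
have Dp : Delta A (alternate X) p.
  split=> // i; have [iX|iX] := boolP (i \in X); last by rewrite ltW // ps.
  by rewrite pX // mulr0.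
split.
  apply/asboolP; split; first by exists p.
  by exists 0 => x [xV xs]; case: (xiV_le0 cX xV).
split; first by rewrite dimV.
exists p; split => // q [ql qs].
have qpV : q - p \in V by apply/(lift_eta_sub q pl).
case: (xiV_le0 cX qpV) => // i iX.
by rewrite !mxE pX // subr0.
Qed.

(** With fewer than [k] changes, [xi] is unbounded on the recession cone; with
    more than [k], the chamber is empty. *)
Lemma inP_alternate b : inP A b -> exists2 X : {set 'I_n}, #|X| = k & b = alternate X.
Proof.
move=> /asboolP[[x [xl xs]] [M bd]]; have [X bE] := alternate_onto b.
exists X => //; subst b; apply/eqP; rewrite eqn_leq; apply/andP; split; last first.
  rewrite leqNgt; apply/negP => /V_weak_sign_pattern[v [vV v0 vs]].
  (* xi takes the value |M| + 1 at t v. *)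
  pose t := (`|M| + 1) / xiV A v.
  have t0 : 0 <= t by rewrite divr_ge0 ?addr_ge0 // ltW.
  have /bd : Sigma A (alternate X) (t *: v).
    by split=> [|i]; rewrite ?rpredZ // mxE mulrCA mulr_ge0.
  rewrite -[_ *: v]addr0 xiVP xiV0 addr0 /t mulfVK ?gt_eqF //.
  by rewrite leNgt ltr_pwDr // ler_norm.
rewrite leqNgt; apply/negP => kX.
have [f [fi fX fb]] := incr_enum kX.
have [r] := V_eta_alternates xl fi; have := xs (f r).
rewrite ffunE signr_odd belowS fX fb addn1 exprS mulN1r mulNr oppr_ge0 => h1 h2.
by have := lt_le_trans h2 h1; rewrite ltxx.
Qed.

(** By the equality case of [xiV_le0] the maximum of [xi] on a chamber is
    attained at one point only, and this point determines [X] because it has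
    no zero coordinate outside [X]. *)
Lemma xset_alternate b (X : {set 'I_n}) : inP A b -> is_xset A b X ->
  #|X| = k /\ b = alternate X.
Proof.
move=> /inP_alternate[Y cY ->] [cX [p [HX Dp pmax]]].
have {}cX : #|X| = k by rewrite cX.
split=> //; congr (alternate _).
have [_ [_ [q [HY Dq qmax]]]] := alternate_in cY.
have [ql qY] : Hflat A Y q by rewrite HY.
have [pl pX] : Hflat A X p by rewrite HX.
have pqV : p - q \in V by apply/(lift_eta_sub p ql).
have opp : xiV A (q - p) = - xiV A (p - q).
  by rewrite -[q - p]opprB -scaleN1r -[_ *: _]addr0 xiVP xiV0 addr0 mulN1r.
have [_ eq0] : xiV A (p - q) <= 0 ?= iff (p - q == 0).
  apply: (xiV_le0 cY pqV) => i iY.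
  by rewrite !mxE qY // subr0; apply: Dp.2.
have /eqP pq : p == q.
  rewrite -subr_eq0 -eq0 eq_le qmax //=.
  by have := pmax q Dq; rewrite opp oppr_le0.
have [p' [HX' ps]] := vertex_signs cX.
have p'p : p = p' by have : Hflat A X p by []; rewrite HX'.
apply/eqP; rewrite eqEcard cX cY leqnn andbT; apply/fintype.subsetP => i iY.
apply: contraT => /ps; rewrite -p'p pq qY // mulr0 ltxx //.
Qed.

Lemma corrP b y : corr A b y <-> exists X : {set 'I_n},
  [/\ #|X| = k, b = alternate X & y = [set lo i | i in X]].
Proof.
split=> [[bP [X bX ->]]|[X [cX -> ->]]].
  by have [cX bE] := xset_alternate bP bX; exists X.
by have [h1 h2] := alternate_in cX; split => //; exists X.
Qed.

End LeftCyclic.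

(** * Generators of the diagram and sets of flipped entries *)

Lemma below_setC n (X : {set 'I_n}) (m : nat) : (m <= n)%N ->
  (below X m + below (~: X) m)%N = m.
Proof.
elim: m => [|m IH] mn; first by rewrite !below0.
rewrite (belowS X (Ordinal mn)) (belowS (~: X) (Ordinal mn)) inE addnACA (IH (ltnW mn)).
by case: (_ \in X); rewrite ?addn0 addn1.
Qed.

Lemma lo_inj n : injective (@lo n).
Proof. by move=> a b /(congr1 val) /= /val_inj. Qed.

Section Generators.
Variables (n : nat) (S : {set 'I_n}).
Implicit Types (g : gen S) (j : blue S).

Definition unoccupied g : {set 'I_n} := ~: [set sval g j | j : blue S].

Definition raised g : {set 'I_n} :=
  [set sval j | j : blue S & sval g j == (sval j).+1 :> nat].

Lemma blue_eq j j' : (sval j == sval j') = (j == j').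
Proof. exact: (inj_eq val_inj). Qed.

Lemma gen_inj g : injective (sval g).
Proof. by case: g => f /= /andP[/injectiveP]. Qed.

Lemma mem_raised g j : (sval j \in raised g) = (sval g j == (sval j).+1 :> nat).
Proof. by rewrite mem_imset ?inE //; apply: val_inj. Qed.

Lemma gen_step g j : sval g j = (sval j + (sval j \in raised g))%N :> nat.
Proof.
rewrite mem_raised; case: (valP g) => /andP[_ /forallP/(_ j)].
rewrite -/(sval g); case: (sval g j =P _.+1 :> nat) => [->|ne]; first by rewrite addn1.
by rewrite orbF addn0 => /eqP.
Qed.

Lemma raised_subC g : raised g \subset ~: S.
Proof. by apply/fintype.subsetP => i /imsetP[j _ ->]; rewrite inE (valP j). Qed.

Lemma raised_inj : injective raised.
Proof.
move=> g g' e; apply/val_inj/ffunP => j; apply/val_inj => /=.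
by rewrite -/(sval g) -/(sval g') !gen_step e.
Qed.

Lemma below_blue (m : nat) : below (~: S) m = #|[set j : blue S | (sval j < m)%N]|.
Proof.
rewrite -[RHS](card_imset _ val_inj); apply: eq_card => i; rewrite !inE.
apply/andP/imsetP => [[iS im]|[j]]; first by exists (exist _ i iS); rewrite ?inE.
by rewrite inE => h ->; rewrite (valP j).
Qed.

Lemma below_occupied g (m : nat) :
  below [set sval g j | j : blue S] m = #|[set j | (sval g j < m)%N]|.
Proof.
rewrite -[RHS](card_imset _ (@gen_inj g)); apply: eq_card => i; rewrite !inE.
apply/andP/imsetP => [[/imsetP[j _ ->] im]|[j]]; first by exists j; rewrite ?inE.
by rewrite inE => h ->; split => //; apply: imset_f.
Qed.

(** The points of [g] below [i + 1] are on the blue circles below [i + 1], with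
    the possible exception of circle [i], whose point may be on arc [i + 1]. *)
Lemma below_unoccupied g (i : 'I_n) :
  below (unoccupied g) i.+1 = (below S i.+1 + (i \in raised g))%N.
Proof.
have := below_setC (unoccupied g) (ltn_ord i); have := below_setC S (ltn_ord i).
rewrite finset.setCK below_occupied below_blue.
have -> : #|[set j : blue S | (sval j < i.+1)%N]|
    = ((i \in raised g) + #|[set j | (sval g j < i.+1)%N]|)%N.
  have [ir|ir] := boolP (i \in raised g).
    have /imsetP[j0 _ iE] := ir.
    have -> : [set j : blue S | (sval j < i.+1)%N] = j0 |: [set j | (sval g j < i.+1)%N].
      apply/setP => j; rewrite !inE gen_step.
      have [->|ne] := eqVneq j j0; first by rewrite /= iE ltnSn.
      have nat_ne : (sval j != i :> nat) 
        by apply: contra ne => /eqP e; apply/eqP/val_inj/val_inj; rewrite /= e iE.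
      rewrite /= !ltnS; case: (_ \in _); rewrite ?addn0 ?addn1 //.
      by rewrite leq_eqVlt (negbTE nat_ne).
    by rewrite cardsU1 !inE gen_step -iE ir addn1 ltnn.
  apply: eq_card => j; rewrite !inE gen_step.
  have [jr|_] := boolP (_ \in _); last by rewrite addn0.
  rewrite addn1 !ltnS leq_eqVlt; case: eqP => // e.
  by case/negP: ir; rewrite -(_ : sval j = i) //; apply: val_inj.
by rewrite addnA => e1 e2; apply/eqP; rewrite -(eqn_add2r #|[set j | (sval g j < i.+1)%N]|) e1 e2.
Qed.

Lemma alternate_unoccupied g :
  flip (alternate S) (raised g) = alternate (unoccupied g).
Proof. by apply/ffunP => i; rewrite !ffunE below_unoccupied oddD oddb. Qed.

Lemma card_unoccupied g : #|unoccupied g| = #|S|.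
Proof.
rewrite cardsCs finset.setCK card_imset; last exact: gen_inj.
rewrite [X in (_ - X)%N](_ : _ = #|~: S|); last first.
  by rewrite card_sig; apply: eq_card => i; rewrite !inE.
by rewrite cardsCs finset.setCK subKn // max_card.
Qed.

(** The parity condition fixes membership in [X] one index at a time. A block of
    consecutive elements of [T] that ends just before an element [s] of [S]
    moves [s] to the start of the block. A block that ends otherwise
    contributes at least one element to [X] without removing one, so [X] and
    [S] could not have the same size. *)
Lemma flipped_blocks (T X : {set 'I_n}) : T \subset ~: S -> #|X| = #|S| ->
  flip (alternate S) T = alternate X ->
  forall i : 'I_n, i \in T -> exists2 i' : 'I_n, i' = i.+1 :> nat & (i' \in S) || (i' \in T).
Proof.
move=> TS cX /ffunP e.
(* prev m says that m - 1 is in T; the elements of ends follow a block of T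
   without being in S. *)
pose prev (m : nat) := [exists i : 'I_n, (i.+1 == m) && (i \in T)].
have prevS (i : 'I_n) : prev i.+1 = (i \in T).
  apply/existsP/idP => [[i' /andP[/eqP[]/val_inj->]]//|iT].
  by exists i; rewrite eqxx.
have prev0 : prev 0%N = false by apply/existsP => -[i /andP[]].
pose ends := [set i : 'I_n | [&& prev i, i \notin S & i \notin T]].
have count (m : nat) : (m <= n)%N ->
    below X m = (below S m + prev m + (below ends m).*2)%N.
  elim: m => [|m IH] mn; first by rewrite !below0 prev0.
  pose i := Ordinal mn; have := e i; have {IH} := IH (ltnW mn).
  rewrite !ffunE -[m.+1]/(i.+1) -[m]/(val i) !belowS prevS !oddD => /= ->.
  rewrite !oddD odd_double !oddb !inE.
  have : (i \in T) ==> (i \notin S).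
    by apply/implyP => iT; have := fintype.subsetP TS _ iT; rewrite inE.
  case: (i \in X); case: (i \in S); case: (i \in T); case: (prev i) => //= _;
    case: (odd _) => //= _; rewrite ?addn0 ?addn1 ?doubleS ?addnS //.
have := count n (leqnn n); rewrite !below_full cX.
move/eqP; rewrite -addnA -[X in X == _]addn0 eqn_add2l eq_sym addn_eq0.
rewrite double_eq0 cards_eq0 eqb0 => /andP[/existsPn last0 /eqP ends0] i iT.
have i1n : (i.+1 < n)%N.
  rewrite ltn_neqAle ltn_ord andbT; apply/negP => /eqP i1.
  by have := last0 i; rewrite i1 eqxx iT.
exists (Ordinal i1n) => //; have : Ordinal i1n \notin ends by rewrite ends0 inE.
by rewrite inE /= prevS iT /= negb_and !negbK.
Qed.

Lemma gen_of_flip (T X : {set 'I_n}) : T \subset ~: S -> #|X| = #|S| ->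
  flip (alternate S) T = alternate X -> exists g, raised g = T.
Proof.
move=> TS cX TX; have blocks := flipped_blocks TS cX TX.
pose G (j : blue S) : 'I_n := insubd (sval j) (sval j + (sval j \in T))%N.
have GE j : G j = (sval j + (sval j \in T))%N :> nat.
  rewrite val_insubd; case: ifP => // /negbT; rewrite -leqNgt.
  have [jT|_] := boolP (_ \in _); last by rewrite addn0.
  by have [i' i'E _] := blocks _ jT; rewrite addn1 -i'E leqNgt ltn_ord.
have no_clash j j' : sval j' = (sval j).+1 :> nat -> G j != G j'.
  move=> e; rewrite -(inj_eq val_inj) /= !GE e.
  have [jT|_] := boolP (sval j \in T); last first.
    by rewrite addn0 addSn ltn_eqF // ltnS leq_addr.
  have [i' i'E] := blocks _ jT.
  have -> : i' = sval j' by apply: val_inj; rewrite /= i'E e.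
  by rewrite (negbTE (valP j')) /= => ->; rewrite !addn1 ltn_eqF.
have Ginj : injective G.
  move=> j j' e; apply/val_inj/val_inj => /=.
  have := congr1 val e; rewrite /= !GE.
  have := no_clash j j'; have := no_clash j' j; rewrite e eqxx => h h'.
  case: (_ \in T); case: (_ \in T); rewrite ?addn0 ?addn1 => // e'; first by case: e'.
    by have := h' (esym e').
  by have := h e'.
have Ggen : is_gen [ffun j => G j].
  apply/andP; split; first by apply/injectiveP => j j'; rewrite !ffunE => /Ginj.
  apply/forallP => j; rewrite !ffunE GE.
  by case: (_ \in T); rewrite ?addn0 ?addn1 eqxx ?orbT.
exists (exist (@is_gen n S) _ Ggen); apply/setP => i; apply/imsetP/idP => [[j]|iT].
  rewrite inE /= ffunE GE => + ->; case: (_ \in T) => //.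
  by rewrite addn0 eqn_leq ltnn andbF.
have iS : i \notin S by have := fintype.subsetP TS _ iT; rewrite inE.
by exists (exist (fun i => i \notin S) i iS) => //; rewrite inE /= ffunE GE /= iT addn1.
Qed.

(** A generator is determined on each blue circle by whether the circle is
    raised, so agreement off [j] is agreement of the raised sets off [j]. *)
Lemma bigonP j g g' :
  bigon j g g' = (sval j \in raised g) && (raised g' == raised g :\ sval j).
Proof.
apply/and3P/andP => [[gj g'j /forallP same]|[jr /eqP e]].
  rewrite mem_raised gj; split => //; apply/eqP/setP => i; rewrite in_setD1.
  have [iS|iS] := boolP (i \in S).
    have out h : (i \in raised h) = false.
      by apply/negP => /(fintype.subsetP (raised_subC h)); rewrite inE iS.
    by rewrite !out andbF.
  rewrite -[i]/(sval (exist (fun i => i \notin S) i iS)); set j' : blue S := exist _ i iS.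
  rewrite !mem_raised; have [->|ne] := eqVneq j' j.
    by rewrite eqxx (eqP g'j) eqn_leq ltnn andbF.
  by rewrite blue_eq ne /=; have := same j'; rewrite ne /= => /eqP ->.
split; first by rewrite -mem_raised.
  by rewrite gen_step e in_setD1 eqxx addn0.
apply/forallP => j'; apply/implyP => ne; apply/eqP/val_inj => /=.
by rewrite !gen_step e in_setD1 blue_eq ne.
Qed.

(** The arc [j] is free in [g] because [g'] occupies it, and the arc [j + 1] is
    free in [g'] because [g] occupies it. *)
Lemma bigon_Rrel j g g' : bigon j g g' -> Rrel (sval j) (yset g) (yset g').
Proof.
case/and3P => /eqP gj /eqP g'j /forallP same.
have hiE : hi (sval j) = lo (sval g j) by apply: val_inj; rewrite /= gj.
have g'jE : sval g' j = sval j by apply: val_inj.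
have memlo h a : (lo a \in yset h) = (a \in unoccupied h).
  by rewrite mem_imset //; apply: lo_inj.
have occ (h : gen S) j' : sval h j' \notin unoccupied h by rewrite inE negbK imset_f.
have sub_out a : a \in unoccupied g -> a != sval j -> a \in unoccupied g'.
  rewrite !inE => aU aj; apply: contra aU => /imsetP[j' _ aE].
  have [j'E|ne] := eqVneq j' j; first by rewrite aE j'E g'jE eqxx in aj.
  by have := same j'; rewrite ne aE => /eqP ->; apply: imset_f.
have sub_in a : a \in unoccupied g' -> a != sval g j -> a \in unoccupied g.
  rewrite !inE => aU aj; apply: contra aU => /imsetP[j' _ aE].
  have [j'E|ne] := eqVneq j' j; first by rewrite aE j'E eqxx in aj.
  by have := same j'; rewrite ne aE => /eqP <-; apply: imset_f.
have jne : sval j != sval g j by rewrite -(inj_eq val_inj) /= gj ltn_eqF.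
have jU : sval j \in unoccupied g.
  rewrite inE; apply/imsetP => -[j' _ e].
  have ne : j' != j by apply: contraNneq jne => j'E; rewrite e j'E.
  have := same j'; rewrite ne -e -g'jE => /eqP/gen_inj e'.
  by rewrite e' eqxx in ne.
have gjU : sval g j \in unoccupied g'.
  rewrite inE; apply/imsetP => -[j' _ e].
  have [j'E|ne] := eqVneq j' j; first by rewrite e j'E g'jE eqxx in jne.
  have := same j'; rewrite ne -e => /eqP/gen_inj e'.
  by rewrite e' eqxx in ne.
rewrite /Rrel hiE; apply/andP; split; apply/eqP/setP => z; rewrite !inE.
  have [->|_] := eqVneq z (lo (sval j)); first by rewrite memlo jU.
  by have [->|_] := eqVneq z; rewrite ?andbF //= memlo (negbTE (occ _ _)).
have zlo (h : gen S) : z \in yset h -> exists2 a, z = lo a & a \in unoccupied h.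
  by case/imsetP => a aU ->; exists a.
have [->|zj] := eqVneq z (lo (sval g j)); first by rewrite orbT memlo gjU.
rewrite orbF; apply/idP/andP => [/zlo[a za aU]|[zi /zlo[a za aU]]]; subst z.
  split; first by apply: contraTneq aU => /lo_inj ->; rewrite -g'jE (negbTE (occ _ _)).
  by rewrite memlo sub_in //; apply: contraNneq zj => ->.
by rewrite memlo sub_out //; apply: contraNneq zi => ->.
Qed.

End Generators.

(** * The comparison of the two complexes *)

Lemma big_inj_support (V : nmodType) (I J : finType) (h : I -> J) (F : J -> V) :
  injective h -> (forall j, j \notin codom h -> F j = 0) ->
  \sum_j F j = \sum_i F (h i).
Proof.
move=> hi F0; rewrite (bigID (mem [set h i | i : I])) /= addrC big1 ?add0r => [|j jn].
  by rewrite big_imset //= => i i' _ _ /hi.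
apply: F0; apply: contra jn => /codomP[i ->]; exact: imset_f.
Qed.

Lemma flip_setD1 n (a : signs n) (T : {set 'I_n}) (i : 'I_n) : i \in T ->
  flip a (T :\ i) = flip (flip a T) [set i].
Proof.
move=> iT; apply/ffunP => j; rewrite !ffunE !inE.
by have [->|_] := eqVneq j i; rewrite ?iT ?addbK ?addbF // addbT addbT negbK.
Qed.

Lemma coor_idem (B : pzRingType) (I : finType) (u : I -> idem B) (p : dsum u) i :
  coor p i * ival (u i) = coor p i.
Proof. by have /forallP/(_ i)/eqP := valP p. Qed.

Lemma coorP (B : pzRingType) (I : finType) (u : I -> idem B) c (p q : dsum u) i :
  coor (c *: p + q) i = c * coor p i + coor q i.
Proof. by rewrite /coor /= !ffunE. Qed.

Lemma dsum_inj (B : pzRingType) (I : finType) (u : I -> idem B) (p q : dsum u) :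
  (forall i, coor p i = coor q i) -> p = q.
Proof. by move=> e; apply/val_inj/ffunP. Qed.

Lemma eB_notin (R : realType) n (A : arrangement R n) (b : signs n) :
  ~~ inP A b -> ival (eB A b) = 0.
Proof. by move=> h; rewrite /= /fB insubN. Qed.

(** A sum of projectives is transported along a ring morphism summand by summand,
    so [tau] has to reach only the nonzero summands of the source. *)
Section Change.
Variables (B C : pzRingType) (phi : {rmorphism B -> C}) (I J : finType).
Variables (u : J -> idem B) (v : I -> idem C) (tau : I -> J).
Hypothesis phi_idem : forall i, phi (ival (u (tau i))) = ival (v i).

Lemma transport_subproof (p : dsum u) :
  @dsum_pred C I v [ffun i => phi (coor p (tau i))].
Proof. by apply/forallP => i; rewrite ffunE -phi_idem -rmorphM coor_idem. Qed.

Definition transport (p : dsum u) : dsum v :=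
  exist (dsum_pred v) _ (transport_subproof p).

Lemma coor_transport p i : coor (transport p) i = phi (coor p (tau i)).
Proof. by rewrite /coor /= ffunE. Qed.

Lemma transport_semilinear c p q :
  transport (c *: p + q) = phi c *: transport p + transport q.
Proof.
apply: dsum_inj => i.
by rewrite coorP !coor_transport coorP rmorphD rmorphM.
Qed.

Hypotheses (tau_inj : injective tau)
  (u0 : forall j, j \notin codom tau -> ival (u j) = 0).

Lemma coor_out p j : j \notin codom tau -> coor (p : dsum u) j = 0.
Proof. by move=> jt; rewrite -coor_idem u0 // mulr0. Qed.

Lemma transport_bij : bijective phi -> bijective transport.
Proof.
case=> psi phiK psiK.
pose f (q : dsum v) : {ffun J -> B^o} :=
  [ffun j => if [pick i | tau i == j] is Some i then psi (coor q i) else 0].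
have fP q : @dsum_pred B J u (f q).
  apply/forallP => j; rewrite ffunE; case: pickP => [i /eqP <-|_]; last by rewrite mul0r.
  by apply/eqP/(can_inj phiK); rewrite rmorphM phi_idem psiK coor_idem.
have fE q i : f q (tau i) = psi (coor q i).
  rewrite ffunE; case: pickP => [i' /eqP/tau_inj -> //|/(_ i)].
  by rewrite eqxx.
exists (fun q => exist (dsum_pred u) _ (fP q)) => [p|q]; apply: dsum_inj => j.
  have [/codomP[i ->]|jt] := boolP (j \in codom tau); last by rewrite !coor_out.
  by rewrite /coor /= fE coor_transport phiK.
by rewrite coor_transport /coor /= fE psiK.
Qed.

Lemma transport_right_mult (M : J -> J -> B) (N : I -> I -> C) :
  (forall i i', phi (M (tau i) (tau i')) = N i i') ->
  forall p, transport (right_mult M p) = right_mult N (transport p).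
Proof.
move=> MN p; apply: dsum_inj => i'.
rewrite coor_transport /coor /= !ffunE rmorph_sum (big_inj_support tau_inj) /=.
  apply: eq_bigr => i _.
  by rewrite !rmorphM phi_idem MN -coor_transport.
by move=> j jt; rewrite coor_out // !mul0r rmorph0.
Qed.

End Change.

Theorem theorem8p11 (R : realType) (n k : nat) (A : arrangement R n)
    (S : {set 'I_n}) (a : signs n) (phi : {rmorphism Btilde A -> Bl n k}) :
  (k <= n)%N ->
  polarized A k ->
  left_cyclic A k ->
  #|S| = k ->
  inP A a -> is_xset A a S ->
  OS_iso phi ->
  exists tau : gen S -> subC S,
    [/\ injective tau,
        forall T, (exists g, tau g = T) <-> inP A (flip a (sval T)),
        forall g b, corr A b (yset g) <-> b = flip a (sval (tau g))
      & exists Phi : resol A a S -> XS k S,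
        [/\ bijective Phi,
            forall c p q, Phi (c *: p + q) = phi c *: Phi p + Phi q,
            forall p g, coor (Phi p) g = phi (coor p (tau g))
          & forall p, Phi (dresol p) = dX (Phi p)]].
Proof.
move=> kn pol cyc cS aP aS [phi_bij phi_e _ phi_f].
have [_ ->] := xset_alternate kn pol cyc aP aS.
pose tau (g : gen S) : subC S := exist _ (raised g) (raised_subC g).
have tau_inj : injective tau by move=> g g' /(congr1 val)/raised_inj.
have flipE g : flip (alternate S) (sval (tau g)) = alternate (unoccupied g).
  exact: alternate_unoccupied.
have corr_tau g b : corr A b (yset g) <-> b = flip (alternate S) (sval (tau g)).
  rewrite flipE; split=> [/(corrP kn pol cyc)[X [_ ->]]|->].
    by move/(imset_inj (@lo_inj n)) => <-.
  by apply/(corrP kn pol cyc); exists (unoccupied g); rewrite card_unoccupied.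
have tau_im T : (exists g, tau g = T) <-> inP A (flip (alternate S) (sval T)).
  split=> [[g <-]|/(inP_alternate kn cyc)[X cX e]].
    by have /corr_tau[] := erefl (flip (alternate S) (sval (tau g))).
  have [g gT] := gen_of_flip (valP T) (etrans cX (esym cS)) e.
  by exists g; apply: val_inj.
have out0 T : T \notin codom tau -> ival (eB A (flip (alternate S) (sval T))) = 0.
  by move=> h; apply: eB_notin; apply: contra h => /tau_im[g <-]; apply: codom_f.
have phi_idem g : phi (ival (eB A (flip (alternate S) (sval (tau g))))) = ival (lI k (yset g)).
  by apply: phi_e; apply/corr_tau.
exists tau; split => //.
exists (@transport _ _ phi _ _
  (fun T : subC S => eB A (flip (alternate S) (sval T)))
  (fun g => lI k (yset g)) tau phi_idem); split.
- exact: transport_bij.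
- exact: transport_semilinear.
- exact: coor_transport.
apply: transport_right_mult => // g g'; rewrite rmorph_sum /=.
have -> : \sum_(j | bigon j g g') lR k (sval j) (yset g) (yset g') =
    \sum_(i in [set sval j | j : blue S & bigon j g g']) lR k i (yset g) (yset g').
  rewrite big_imset /=; first by apply: eq_bigl => j; rewrite inE.
  by move=> j j' _ _ /= /eqP; rewrite blue_eq => /eqP.
apply: eq_big => [i|i /andP[ig /eqP e]].
  apply/andP/imsetP => [[ir e]|[j]]; last by rewrite inE bigonP => /andP[? ?] ->.
  have iS : i \notin S by have := fintype.subsetP (raised_subC g) _ ir; rewrite inE.
  by exists (exist (fun i => i \notin S) i iS) => //; rewrite inE bigonP /= ir.
have gg' : flip (alternate S) (sval (tau g')) = flip (flip (alternate S) (sval (tau g))) [set i].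
  by rewrite /= e flip_setD1.
have /corr_tau cg := erefl (flip (alternate S) (sval (tau g))).
have /corr_tau cg' := erefl (flip (alternate S) (sval (tau g'))).
apply: (phi_f _ _ _ _ _ cg cg' gg').1.
have iS : i \notin S by have := fintype.subsetP (raised_subC g) _ ig; rewrite inE.
apply: (@bigon_Rrel n S (exist _ i iS)).
by rewrite bigonP /= ig; apply/eqP.
Qed.
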